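(* For every positive integer $d$ there exist positive constants $c_d, C_d$ (depending only on $d$) such that for all positive integers $N_1,\dots,N_d$ with $N_1\cdots N_d\ge 3$, letting $\mathbf{N}=(N_1,\dots,N_d)$, \[ c_d\max_{I\subseteq[d]}\Big(\prod_{i\in I}N_i\Big)^{\frac{1}{2|I|+2}} \le \operatorname{disc}(\mathcal{A}_{\mathbf{N}}) \le C_d\,\frac{\log(N_1\cdots N_d)}{\log\log(N_1\cdots N_d)}\cdot\max_{I\subseteq[d]}\Big(\prod_{i\in I}N_i\Big)^{\frac{1}{2|I|+2}}, \] where for $I=\emptyset$ the product $\prod_{i\in I}N_i$ is taken to be $1$.
   Context: For $N\in\mathbb{N}$ write $[N]=\{1,\dots,N\}$; logarithms are natural. An arithmetic progression in $d$ dimensions is a set $\{\mathbf{a}+i\mathbf{b}: i=0,1,\dots,l-1\}$ with $\mathbf{a},\mathbf{b}\in\mathbb{Z}^d$, $\mathbf{b}\neq\mathbf{0}$, $l\in\mathbb{N}$. For $\mathbf{N}=(N_1,\dots,N_d)$, let $\Omega=[N_1]\times\cdots\times[N_d]$ and let $\mathcal{A}_{\mathbf{N}}$ be the family of arithmetic progressions in $d$ dimensions contained in $\Omega$. For $\chi:\Omega\to\{1,-1\}$ and $A\subseteq\Omega$ put $\chi(A)=\sum_{x\in A}\chi(x)$, and $\operatorname{disc}(\mathcal{A}_{\mathbf{N}})=\min_{\chi:\Omega\to\{1,-1\}}\max_{A\in\mathcal{A}_{\mathbf{N}}}|\chi(A)|$. *)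

(* Defs.v *)
From HB Require Import structures.
From mathcomp Require Import all_boot all_order all_algebra.
From mathcomp Require Import boolp reals exp.
Set Implicit Arguments. Unset Strict Implicit. Unset Printing Implicit Defensive.
Import Order.TTheory GRing.Theory Num.Theory.
Local Open Scope ring_scope.

(* The box Omega = [N_1] x ... x [N_d]; an element x represents the point
   (x i + 1)_i of Z^d. *)
Definition Omega (d : nat) (N : 'I_d -> nat) : finType :=
  {dffun forall i : 'I_d, 'I_(N i)}.

Definition pt (d : nat) (N : 'I_d -> nat) (x : Omega N) : 'I_d -> int :=
  fun i => ((x i : nat)%:Z + 1)%R.

Definition in_box (d : nat) (N : 'I_d -> nat) (p : 'I_d -> int) : Prop :=
  forall i, (1 <= p i)%R /\ (p i <= (N i)%:Z)%R.

Definition is_AP (d : nat) (N : 'I_d -> nat) (A : {set Omega N}) : Prop :=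
  exists (a b : 'I_d -> int) (l : nat),
    (exists i, b i != 0) /\ (0 < l)%N /\
    (forall k, (k < l)%N -> in_box N (fun i => a i + k%:Z * b i)) /\
    (forall x : Omega N, x \in A <->
       exists2 k, (k < l)%N & forall i, pt x i = a i + k%:Z * b i).

Definition chi_sum (d : nat) (N : 'I_d -> nat) (chi : {ffun Omega N -> bool})
  (A : {set Omega N}) : int :=
  \sum_(x in A) (if chi x then 1 else -1).

(* disc(A_N) = min over colourings of max over APs in Omega of |chi(A)|.
   The idx #|Omega N| of the min is harmless since every |chi(A)| <= #|Omega N|. *)
Definition disc (d : nat) (N : 'I_d -> nat) : nat :=
  \big[minn/#|Omega N|]_(chi : {ffun Omega N -> bool})
     \max_(A : {set Omega N} | `[< is_AP A >]) `|chi_sum chi A|%N.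

Definition Mfac (R : realType) (d : nat) (N : 'I_d -> nat) : R :=
  \big[Num.max/0]_(I : {set 'I_d})
     (((\prod_(i in I) N i)%N)%:R `^ (1 / ((2 * #|I| + 2)%N)%:R)).

(* Main.v *)
Require Import Defs.
From HB Require Import structures.
From mathcomp Require Import all_boot all_order all_algebra.
From mathcomp Require Import boolp reals exp.
From mathcomp Require Import sequences zify ring lra.
Set Implicit Arguments. Unset Strict Implicit. Unset Printing Implicit Defensive.
Import Order.TTheory GRing.Theory Num.Theory.
Local Open Scope ring_scope.

(* Lower bound.  Let f be a colouring extended by 0 to Z^d, and let B be a box
   of the form prod_e [0, tau_e).  The sum over all b, b' in B and all a of
   |sum_(j < l) f(a + j(b - b'))|^2 equals the sum over all j, j' < l and all a
   of |sum_(b in B) f(a + (j - j')b)|^2, because both are sums of the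
   autocorrelation of f at (j' - j)(b - b').  Keeping only the terms j = j'
   bounds it below by l |B|^2 |Omega|, so some progression of difference
   b - b' <> 0 has discrepancy of order sqrt l as soon as 2 l <= |B|.  With
   L = (prod_(i in I) N_i)^(1/(|I|+1)), one takes l ~ L/2 and
   tau_e ~ N_e / L for e in I.

   Upper bound.  Let M be the maximum in the theorem and L = M^2.  The incidence
   matrix of points and prefixes (initial segments of lines in the box) factors
   through vectors of squared norm at most 1 for the points and O_d(L) for the
   prefixes: a prefix is cut into aligned blocks of lengths 2^i s0, with
   s0 ~ L, and fewer than s0 single points, and there are only O_d(L / 2^i)
   differences with a progression of length 2^i s0 in the box, so that weights
   proportional to (3/2)^i / L balance both sides.  The Gram-Schmidt walk of
   Bansal, Dadush, Garg and Lovett, which is subgaussian by the argument of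
   Harshaw, Savje, Spielman and Zhang, gives signs for which all prefix sums
   are O_d(sqrt(L log(N_1 ... N_d))), and sqrt(log P) = O(log P / log log P). *)

(** * Orthogonal projections on spans of finite families *)

Section Dot.
Variables (R : realType) (T : finType).
Implicit Types f g h : {ffun T -> R^o}.

Definition dot f g : R := \sum_t (f t : R) * g t.

Lemma dotC f g : dot f g = dot g f.
Proof. by apply: eq_bigr => t _; rewrite mulrC. Qed.

Lemma dotDl f g h : dot (f + g) h = dot f h + dot g h.
Proof. by rewrite -big_split; apply: eq_bigr => t _; rewrite ffunE mulrDl. Qed.

Lemma dotZl a f g : dot (a *: f) g = a * dot f g.
Proof. by rewrite mulr_sumr; apply: eq_bigr => t _; rewrite ffunE mulrA. Qed.

Lemma dotNl f g : dot (- f) g = - dot f g.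
Proof. by rewrite -scaleN1r dotZl mulN1r. Qed.

Lemma dotBl f g h : dot (f - g) h = dot f h - dot g h.
Proof. by rewrite dotDl dotNl. Qed.

Lemma dotDr f g h : dot h (f + g) = dot h f + dot h g.
Proof. by rewrite dotC dotDl !(dotC h). Qed.

Lemma dotZr a f g : dot g (a *: f) = a * dot g f.
Proof. by rewrite dotC dotZl dotC. Qed.

Lemma dotBr f g h : dot h (f - g) = dot h f - dot h g.
Proof. by rewrite dotC dotBl !(dotC h). Qed.

Lemma dotDD f g : dot (f + g) (f + g) = dot f f + dot g g + 2 * dot f g.
Proof. by rewrite dotDl !dotDr (dotC g f); ring. Qed.

Lemma dot0l f : dot 0 f = 0.
Proof. by rewrite -(scale0r 0) dotZl mul0r. Qed.

Lemma dot_suml (I : finType) (F : I -> {ffun T -> R^o}) h :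
  dot (\sum_i F i) h = \sum_i dot (F i) h.
Proof.
by apply: (big_morph (fun f => dot f h)) => [f g|]; rewrite ?dotDl ?dot0l.
Qed.

Lemma dot_ge0 f : 0 <= dot f f.
Proof. by apply: sumr_ge0 => t _; rewrite -expr2 sqr_ge0. Qed.

Lemma dot_eq0 f : dot f f = 0 -> f = 0.
Proof.
move=> /eqP; rewrite psumr_eq0 => [/allP f0|t _]; last by rewrite -expr2 sqr_ge0.
apply/ffunP => t; rewrite ffunE.
by have := f0 t (mem_index_enum t); rewrite /= -expr2 sqrf_eq0 => /eqP.
Qed.

Lemma dot_CS f g : dot f g ^+ 2 <= dot f f * dot g g.
Proof.
have [/eqP /dot_eq0 ->|g0] := boolP (dot g g == 0).
  by rewrite dotC !dot0l expr0n mulr0.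
have gp : 0 < dot g g by rewrite lt_def g0 dot_ge0.
have := dot_ge0 (dot g g *: f - dot f g *: g).
rewrite (_ : dot _ _ = dot g g * (dot f f * dot g g - dot f g ^+ 2)); last first.
  by rewrite !(dotBl, dotZl) !(dotBr, dotZr) (dotC g f); ring.
by rewrite pmulr_rge0 // subr_ge0.
Qed.

End Dot.

Section Projection.
Variables (R : realType) (T I : finType) (v : I -> {ffun T -> R^o}).
Implicit Types (A B : {set I}) (y z th : {ffun T -> R^o}).

Definition in_span B z :=
  exists c : I -> R, (forall i, i \notin B -> c i = 0) /\ z = \sum_i c i *: v i.

Definition orth B z := forall i, i \in B -> dot z (v i) = 0.

Lemma in_spanS A B z : A \subset B -> in_span A z -> in_span B z.
Proof.
move=> /subsetP AB [c [c0 ->]]; exists c; split=> // i iB.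
by apply: c0; apply: contra iB; exact: AB.
Qed.

Lemma in_spanD B y z : in_span B y -> in_span B z -> in_span B (y + z).
Proof.
move=> [c [c0 ->]] [e [e0 ->]]; exists (fun i => c i + e i); split.
  by move=> i iB; rewrite c0 // e0 // addr0.
by rewrite -big_split; apply: eq_bigr => i _; rewrite scalerDl.
Qed.

Lemma in_spanZ B a z : in_span B z -> in_span B (a *: z).
Proof.
move=> [c [c0 ->]]; exists (fun i => a * c i); split.
  by move=> i iB; rewrite c0 // mulr0.
by rewrite scaler_sumr; apply: eq_bigr => i _; rewrite scalerA.
Qed.

Lemma in_spanB B y z : in_span B y -> in_span B z -> in_span B (y - z).
Proof. by move=> By Bz; rewrite -scaleN1r; apply/in_spanD/in_spanZ. Qed.

Lemma in_span_gen B i : i \in B -> in_span B (v i).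
Proof.
move=> iB; exists (fun k => (k == i)%:R); split=> [k kB|].
  by case: eqP kB => // ->; rewrite iB.
rewrite (bigD1 i) //= eqxx scale1r big1 ?addr0 // => k /negPf ->.
by rewrite scale0r.
Qed.

Lemma orth_in_span B y z : orth B z -> in_span B y -> dot z y = 0.
Proof.
move=> zB [c [c0 ->]]; rewrite dotC dot_suml big1 // => i _; rewrite dotZl dotC.
have [iB|iB] := boolP (i \in B); first by rewrite zB ?mulr0.
by rewrite c0 ?mul0r.
Qed.

Lemma orthB B y z : orth B y -> orth B z -> orth B (y - z).
Proof. by move=> yB zB i iB; rewrite dotBl yB // zB // subr0. Qed.

Lemma orthS A B z : A \subset B -> orth B z -> orth A z.
Proof. by move=> /subsetP AB zB i iA; apply/zB/AB. Qed.


(** Gram-Schmidt by induction on the size of [B]: project on the span without [v i0], then correct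
    along the residual [w] of [v i0]. The family may be linearly dependent. *)
Lemma proj_exists B th : exists y, in_span B y /\ orth B (th - y).
Proof.
move: {2}#|B| (leqnn #|B|) => n; elim: n B th => [|n IH] B th Bn.
  exists 0; split; first by exists (fun=> 0); split=> //; rewrite big1 // => i _; rewrite scale0r.
  by move: Bn; rewrite leqn0 cards_eq0 => /eqP -> i; rewrite inE.
have [->|[i0 i0B]] := set_0Vmem B; first by apply: IH; rewrite cards0.
have Bn' : (#|B :\ i0| <= n)%N by rewrite (cardsD1 i0 B) i0B in Bn.
have sB : B :\ i0 \subset B by apply: subD1set.
have [y [yB yo]] := IH _ th Bn'; have [x [xB xo]] := IH _ (v i0) Bn'.
pose w := v i0 - x; pose l := dot (th - y) w / dot w w.
have wB : in_span B w by apply: in_spanB; [exact: in_span_gen|exact: in_spanS xB].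
have wx : v i0 = w + x by rewrite subrK.
have wo i : i \in B :\ i0 -> dot w (v i) = 0 by move/xo.
(* If [w = 0], then [l] is a division by zero; the identity survives because both sides vanish. *)
have lww : dot (th - y) w = l * dot w w.
  have [w0|w0] := eqVneq (dot w w) 0; last by rewrite divfK.
  by rewrite w0 mulr0 (dot_eq0 w0) dotC dot0l.
clearbody w l; exists (y + l *: w); split.
  by apply: in_spanD; [exact: in_spanS yB|exact: in_spanZ].
move=> i iB; rewrite opprD addrA dotBl dotZl.
have [->|ii0] := eqVneq i i0; last first.
  have iB' : i \in B :\ i0 by rewrite !inE ii0.
  by rewrite yo // wo // mulr0 subr0.
by rewrite wx !dotDr (orth_in_span yo xB) (orth_in_span wo xB) lww !addr0 subrr.
Qed.

Definition proj B th := projT1 (cid (proj_exists B th)).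

Lemma proj_span B th : in_span B (proj B th).
Proof. by rewrite /proj; case: cid => y []. Qed.

Lemma proj_orth B th : orth B (th - proj B th).
Proof. by rewrite /proj; case: cid => y []. Qed.
Arguments proj_orth B th : clear implicits.

Definition nproj B th := dot (proj B th) (proj B th).

Lemma nproj_ge0 B th : 0 <= nproj B th. Proof. exact: dot_ge0. Qed.

Lemma nproj_diff A B th : A \subset B ->
  nproj B th - nproj A th = dot (proj B th - proj A th) (proj B th - proj A th).
Proof.
move=> AB; set d := proj B th - proj A th.
have d0 : dot d (proj A th) = 0.
  apply: orth_in_span (proj_span A th).
  rewrite (_ : d = (th - proj A th) - (th - proj B th)); last first.
    by rewrite /d opprB [RHS]addrC addrA subrK.
  by apply: orthB; [exact: proj_orth|exact: orthS AB (proj_orth _ _)].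
have e : proj B th = d + proj A th by rewrite subrK.
clearbody d; rewrite /nproj e dotDl !dotDr (dotC (proj A th) d) d0.
by rewrite addr0 add0r addrK.
Qed.

Lemma nproj_mono A B th : A \subset B -> nproj A th <= nproj B th.
Proof. by move=> AB; rewrite -subr_ge0 nproj_diff // dot_ge0. Qed.

Lemma dot_resid B th : dot (th - proj B th) (th - proj B th) = dot th th - nproj B th.
Proof.
have := orth_in_span (proj_orth B th) (proj_span B th); rewrite dotBl.
rewrite /nproj dotBl !dotBr (dotC _ th); lra.
Qed.

Lemma nproj_le B th : nproj B th <= dot th th.
Proof. by rewrite -subr_ge0 -dot_resid dot_ge0. Qed.

(** Only the component [proj B th - proj A th] is seen by [z], so Cauchy-Schwarz applies. In the
    walk, this lets the drop of [nproj] pay for the quadratic exponents. *)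
Lemma dot_sq_le_nproj A B th z : A \subset B -> in_span B z -> orth A z ->
  dot th z ^+ 2 <= dot z z * (nproj B th - nproj A th).
Proof.
move=> AB zB zA.
have -> : dot th z = dot (proj B th - proj A th) z.
  rewrite dotBl (dotC (proj A th)) (orth_in_span zA (proj_span A th)) subr0.
  by apply/eqP; rewrite -subr_eq0 -dotBl (orth_in_span (proj_orth B th) zB).
by rewrite nproj_diff // mulrC dot_CS.
Qed.

End Projection.

(** * Exponential inequalities *)

Section ExpBounds.
Variable R : realType.
Implicit Types x y z : R.

Lemma expR_le_quad z : z <= 1 -> expR z <= 1 + z + 2 * z ^+ 2.
Proof.
move=> z1; have E0 := expR_gt0 z.
(* Squaring [1 - z / 2 <= expR (- z / 2)] is legitimate because [z <= 1]; a polynomial inequality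
   then remains. *)
have h : expR z * (1 - z / 2) ^+ 2 <= 1.
  rewrite -[leRHS](expRxMexpNx_1 z) ler_pM2l //.
  rewrite (_ : - z = 2%:R * (- z / 2)); last by field.
  rewrite expRM_natl lerXn2r ?nnegrE ?expR_ge0 //; first by lra.
  by have := expR_ge1Dx (- z / 2); lra.
have q : 1 <= (1 - z / 2) ^+ 2 * (1 + z + 2 * z ^+ 2).
  rewrite -subr_ge0 (_ : _ - 1 = z ^+ 2 * ((1 - z) * (5 - 2 * z) / 4)); last by field.
  by apply: mulr_ge0; [exact: sqr_ge0|rewrite divr_ge0 // mulr_ge0 //; lra].
have q0 : 0 <= 1 + z + 2 * z ^+ 2 by nra.
apply: le_trans (_ : expR z * ((1 - z / 2) ^+ 2 * (1 + z + 2 * z ^+ 2)) <= _).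
  by rewrite ler_peMr // ltW.
by rewrite mulrA ler_piMl.
Qed.

(** The linear term averages to zero under a centred law, which leaves the quadratic exponential. *)
Lemma expR_le_addexp z : expR z <= z + expR (2 * z ^+ 2).
Proof.
have [z1|z1] := leP z 1.
  apply: le_trans (expR_le_quad z1) _.
  by have := expR_ge1Dx (2 * z ^+ 2); lra.
have h : expR z <= expR (2 * z ^+ 2) by rewrite ler_expR; nra.
by apply: le_trans h _; lra.
Qed.

(* A weak form of Hoeffding's lemma, for the law on {-1, 1} of mean [x]. *)
Lemma two_point_mgf x y : -1 <= x -> x <= 1 ->
  (1 + x) / 2 * expR (y * (1 - x)) + (1 - x) / 2 * expR (y * (-1 - x))
    <= expR (8 * y ^+ 2).
Proof.
move=> x1 x2.
have h D : -2 <= D -> D <= 2 -> expR (y * D) <= y * D + expR (8 * y ^+ 2).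
  move=> D1 D2; apply: le_trans (expR_le_addexp _) _.
  rewrite lerD2l ler_expR exprMn.
  (* Deviations are at most 2, so [2 * (y * D) ^+ 2 <= 8 * y ^+ 2]: the origin of the 8 in the
     exponents of the walk. *)
  have : D ^+ 2 <= 4 by nra.
  have := sqr_ge0 y; nra.
have h1 := h (1 - x) ltac:(lra) ltac:(lra).
have h2 := h (-1 - x) ltac:(lra) ltac:(lra).
have p1 : 0 <= (1 + x) / 2 by lra.
have p2 : 0 <= (1 - x) / 2 by lra.
have := lerD (ler_wpM2l p1 h1) (ler_wpM2l p2 h2).
move: (expR _) (expR _) (expR _) => A B C; lra.
Qed.

Lemma expR_tangent y z : expR y * (1 + z - y) <= expR z.
Proof.
rewrite -[in leRHS](subrK y z) [in leRHS]addrC expRD ler_pM2l ?expR_gt0 //.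
by apply: le_trans _ (expR_ge1Dx _); lra.
Qed.

End ExpBounds.

(** * One step of a walk in the cube *)

Section Walk.
Variables (R : realType) (I : finType).
Implicit Types x u : I -> R.

Definition alive x := [set i | x i ^+ 2 != 1].

(** Move along [u] until a first coordinate reaches the boundary of the cube. The coordinate with
    minimal hitting time [s] freezes at a sign, and frozen ones do not move. *)
Lemma walk_step x u p : (forall i, `|x i| <= 1) -> p \in alive x -> u p != 0 ->
    (forall i, i \notin alive x -> u i = 0) ->
  exists2 t : R, 0 < t &
    [/\ forall i, `|x i + t * u i| <= 1,
        alive (fun i => x i + t * u i) \subset alive x
      & (#|alive (fun i => x i + t * u i)%R| < #|alive x|)%N].
Proof.
move=> xb pA up uA.
pose s i := if 0 < u i then (1 - x i) / u i else (-1 - x i) / u i.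
have xlt i : u i != 0 -> -1 < x i /\ x i < 1.
  move=> ui; have iA : x i ^+ 2 != 1.
    by have : i \in alive x by [apply: contraNT ui => /uA ->]; rewrite inE.
  have := xb i; rewrite ler_norml => /andP[h1 h2].
  split; rewrite lt_neqAle ?h1 ?h2 andbT; apply: contra iA => /eqP.
    by move=> <-; rewrite sqrrN expr1n.
  by move=> ->; rewrite expr1n.
have s_gt0 i : u i != 0 -> 0 < s i.
  move=> ui; have [h1 h2] := xlt i ui; rewrite /s; case: (ltP 0 (u i)) => ui0.
    by rewrite divr_gt0 // subr_gt0.
  have un : u i < 0 by rewrite lt_neqAle ui.
  rewrite (_ : (-1 - x i) / u i = (x i + 1) / - u i).
      by rewrite divr_gt0 ?oppr_gt0 //; lra.
    by rewrite invrN mulrN -mulNr opprD addrC.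
case: (@arg_minP _ _ _ p (fun i => u i != 0) s up) => q uq qmin.
have uE i : u i != 0 -> s i * u i = if 0 < u i then 1 - x i else -1 - x i.
  by move=> ui; rewrite /s; case: ifP => _; rewrite divfK.
have t0 := s_gt0 _ uq; exists (s q) => //.
have xb' i : `|x i + s q * u i| <= 1.
  have [->|ui] := eqVneq (u i) 0; first by rewrite mulr0 addr0.
  have := qmin _ ui; have := uE _ ui; have [h1 h2] := xlt i ui.
  rewrite ler_norml; case: ifP => [ui0|/negbT]; first by nra.
  rewrite -leNgt => ui0; nra.
have qN : q \notin alive (fun i => x i + s q * u i).
  by rewrite inE negbK uE //; case: ifP => _; rewrite addrC subrK ?sqrrN expr1n.
have sub : alive (fun i => x i + s q * u i) \subset alive x.
  apply/subsetP => i iA; apply: contraTT iA => ix.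
  by move: (ix); rewrite !inE uA // mulr0 addr0.
split=> //; apply: proper_card; apply/properP; split=> //.
by exists q => //; apply: contraNT uq => /uA ->.
Qed.
End Walk.

(** * The Gram-Schmidt walk *)

Section GramSchmidtWalk.
Variables (R : realType) (T I J : finType) (v : I -> {ffun T -> R^o}).
Variable th : J -> {ffun T -> R^o}.
Hypothesis v_le1 : forall i, dot (v i) (v i) <= 1.
Implicit Types (x : I -> R) (W : J -> R).

Definition comb x : {ffun T -> R^o} := \sum_i x i *: v i.

Lemma combB x y : comb (fun i => x i - y i) = comb x - comb y.
Proof. by rewrite /comb -sumrB; apply: eq_bigr => i _; rewrite scalerBl. Qed.

Lemma combDZ x (t : R) y : comb (fun i => x i + t * y i) = comb x + t *: comb y.
Proof.
rewrite /comb scaler_sumr -big_split; apply: eq_bigr => i _.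
by rewrite scalerDl scalerA.
Qed.

Definition is_sign x := forall i, x i = 1 \/ x i = -1.

(** A derandomized subgaussian bound: one sign vector replaces the expectation over the walk.
    Arbitrary weights [W] let the induction absorb accumulated factors. *)
Definition roundable x := forall W, (forall j, 0 <= W j) ->
  exists2 X, is_sign X &
    \sum_j W j * expR (dot (th j) (comb (fun i => X i - x i)))
      <= \sum_j W j * expR (8 * nproj v (alive x) (th j)).

(** The Gram-Schmidt residual of the pivot vector against the other alive ones; [comb x] moves by it
    per unit change of [x p]. *)
Definition pivot_dir x p := v p - proj v (alive x :\ p) (v p).

(* The invariant of a phase with pivot [p]: [w] is the current residual of [v p],
   and [sp], [sm], [K] accumulate the contributions of its earlier residuals.
   With [Q = |w|^2] and [T e = K j + <th j, w> (e - x p)], the two hypotheses are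
   [exp (T 1 / Q) <= sp j / Q] and [exp (T (-1) / Q) <= sm j / Q], stated with the
   tangent lines of [exp] so that [Q = 0] needs no special case. *)
Definition roundable_pivot x p :=
  let w := pivot_dir x p in
  forall W (sp sm K : J -> R), (forall j, 0 <= W j) ->
  (forall j t, expR t * (dot w w + (K j + dot (th j) w * (1 - x p)) - dot w w * t)
     <= sp j) ->
  (forall j t, expR t * (dot w w + (K j + dot (th j) w * (-1 - x p)) - dot w w * t)
     <= sm j) ->
  exists2 X, is_sign X &
    \sum_j W j * expR (dot (th j) (comb (fun i => X i - x i))
                         - 8 * nproj v (alive x :\ p) (th j) + K j)
      <= \sum_j W j * ((1 + x p) / 2 * sp j + (1 - x p) / 2 * sm j + 1 - dot w w).

Lemma pivot_dir_orth x p : orth v (alive x :\ p) (pivot_dir x p).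
Proof. exact: proj_orth. Qed.

Lemma pivot_dir_span x p : p \in alive x -> in_span v (alive x) (pivot_dir x p).
Proof.
move=> pA; apply: in_spanB; first exact: in_span_gen.
exact: in_spanS (subD1set _ _) (proj_span _ _ _).
Qed.

Lemma pivot_dir_le1 x p : dot (pivot_dir x p) (pivot_dir x p) <= 1.
Proof.
rewrite dot_resid; apply: le_trans (v_le1 p).
by have := nproj_ge0 v (alive x :\ p) (v p); lra.
Qed.

(** Opening of a phase: the term [8 |w|^2 y^2] goes into the weights, where the gain of [nproj] from
    adding [p] pays for it, and [two_point_mgf] bounds the remaining average by 1. *)
Lemma roundable_of_pivot x p : p \in alive x -> `|x p| <= 1 ->
  roundable_pivot x p -> roundable x.
Proof.
move=> pA xp Hp W W0; set w := pivot_dir x p in Hp.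
pose y j := dot (th j) w / dot w w.
have Q0 : 0 <= dot w w := dot_ge0 w.
have Q1 : dot w w <= 1 := pivot_dir_le1 x p.
have ay j : dot (th j) w = dot w w * y j.
  have [w0|w0] := eqVneq (dot w w) 0; last by rewrite mulrC divfK.
  by rewrite w0 mul0r (dot_eq0 w0) dotC dot0l.
pose k (e : R) j := - 8 * y j ^+ 2 + y j * (e - x p).
pose W' j := W j * expR (8 * nproj v (alive x :\ p) (th j) + 8 * (dot w w * y j ^+ 2)).
have W'0 j : 0 <= W' j by rewrite mulr_ge0 ?expR_ge0.
have Hk e j t : expR t * (dot w w + (- 8 * (dot w w * y j ^+ 2)
    + dot (th j) w * (e - x p)) - dot w w * t) <= dot w w * expR (k e j).
  rewrite ay (_ : expR t * _ = dot w w * (expR t * (1 + k e j - t))); last by rewrite /k; ring.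
  by rewrite ler_wpM2l // expR_tangent.
have [X Xs HX] := Hp W' _ _ _ W'0 (Hk 1) (Hk (-1)).
exists X => //.
have WE j : W j * expR (dot (th j) (comb (fun i => X i - x i))) =
   W' j * expR (dot (th j) (comb (fun i => X i - x i))
      - 8 * nproj v (alive x :\ p) (th j) + - 8 * (dot w w * y j ^+ 2)).
  by rewrite /W' -mulrA -expRD; congr (_ * expR _); ring.
rewrite (eq_bigr _ (fun j _ => WE j)); apply: le_trans HX _.
apply: ler_sum => j _.
have W'le : W' j <= W j * expR (8 * nproj v (alive x) (th j)).
  rewrite ler_wpM2l // ler_expR.
  have := dot_sq_le_nproj (th j) (subD1set _ _) (pivot_dir_span pA) (@pivot_dir_orth x p).
  rewrite -/w ay => h.
  suff : dot w w * y j ^+ 2 <= nproj v (alive x) (th j) - nproj v (alive x :\ p) (th j) by lra.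
  have [w0|w0] := eqVneq (dot w w) 0.
    by rewrite w0 mul0r subr_ge0 nproj_mono // subD1set.
  have wp : 0 < dot w w by rewrite lt_def w0.
  by rewrite -(ler_pM2l wp); apply: le_trans h; rewrite mulrA -expr2 -exprMn.
apply: le_trans W'le; rewrite ler_piMr //.
have := xp; rewrite ler_norml => /andP[x1 x2].
have := ler_wpM2l (expR_ge0 (- 8 * y j ^+ 2)) (two_point_mgf (y j) x1 x2).
rewrite -expRD (_ : _ + 8 * _ = 0); last by ring.
rewrite expR0 mulrDr => h.
have {}h : (1 + x p) / 2 * expR (k 1 j) + (1 - x p) / 2 * expR (k (-1) j) <= 1.
  apply: le_trans h; rewrite /k !expRD.
  by move: (expR _) (expR _) (expR _) => A B C; lra.
move: h; move: (expR _) (expR _) => A B h.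
nra.
Qed.

(** After one move either [p] is still alive and the phase continues with a residual at least as
    long, or [p] is a sign and the phase closes through [roundable]. *)
Lemma roundable_pivot_step x p : (forall i, `|x i| <= 1) -> p \in alive x ->
    (forall y, (forall i, `|y i| <= 1) -> (#|alive y| < #|alive x|)%N ->
       roundable y /\ forall q, q \in alive y -> roundable_pivot y q) ->
  roundable_pivot x p.
Proof.
move=> xb pA IH w W sp sm K W0 Hp Hm.
have Q0 : 0 <= dot w w := dot_ge0 w.
have Q1 : dot w w <= 1 := pivot_dir_le1 x p.
have [c [c0 cE]] := proj_span v (alive x :\ p) (v p).
(* This direction realizes the residual, [comb u = w], with speed 1 at the pivot and 0 at frozen
   coordinates. *)
pose u i := (i == p)%:R - c i.
have up : u p = 1 by rewrite /u eqxx c0 ?subr0 // !inE eqxx.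
have u0 i : i \notin alive x -> u i = 0.
  move=> iA; rewrite /u c0; last by rewrite in_setD1 negb_and iA orbT.
  by case: eqP iA => [->|]; rewrite ?pA // subrr.
have uw : comb u = w.
  rewrite /w /pivot_dir cE /u combB; congr (_ - _).
  rewrite /comb (bigD1 p) //= eqxx scale1r big1 ?addr0 // => i /negPf ->.
  by rewrite scale0r.
(* The target bound is affine in [x p], so for one of the two signs moving along
   [u] does not increase it: this choice derandomizes the walk. *)
pose Phi (z : R) := \sum_j W j * ((1 + z) / 2 * sp j + (1 - z) / 2 * sm j + 1 - dot w w).
have [d [xb' sA cA HPhi]] : exists d : R,
    [/\ forall i, `|x i + d * u i| <= 1,
        alive (fun i => x i + d * u i) \subset alive x,
        (#|alive (fun i => x i + d * u i)%R| < #|alive x|)%N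
      & Phi (x p + d) <= Phi (x p)].
  pose S := \sum_j W j * (sp j - sm j) / 2.
  have PhiE d : Phi (x p + d) = Phi (x p) + d * S.
    rewrite /Phi /S mulr_sumr -big_split; apply: eq_bigr => j _ /=; lra.
  have [S0|S0] := leP S 0.
    have up0 : u p != 0 by rewrite up oner_eq0.
    have [t t0 [h1 h2 h3]] := walk_step xb pA up0 u0.
    by exists t; split=> //; rewrite PhiE; nra.
  have up0 : - u p != 0 by rewrite oppr_eq0 up oner_eq0.
  have u0' i : i \notin alive x -> - u i = 0 by move=> /u0 ->; rewrite oppr0.
  have [t t0 [h1 h2 h3]] := @walk_step _ _ _ (fun i => - u i) _ xb pA up0 u0'.
  exists (- t).
  have E i : x i + - t * u i = x i + t * - u i by rewrite mulNr mulrN.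
  have -> : (fun i => x i + - t * u i) = (fun i => x i + t * - u i).
    by apply/funext => i.
  by split=> // [i|]; [rewrite E|rewrite PhiE; nra].
set x' := (fun i => x i + d * u i) in xb' sA cA.
have {}xb' i : `|x' i| <= 1 := xb' i.
have x'p : x' p = x p + d by rewrite /x' up mulr1.
have combX X : comb (fun i => X i - x i) = comb (fun i => X i - x' i) + d *: w.
  by rewrite !combB /x' combDZ uw opprD addrA subrK.
(* The displacement [d *: w] already made is moved into the accumulated exponent [K]. *)
suff [X Xs HX] : exists2 X, is_sign X &
    \sum_j W j * expR (dot (th j) (comb (fun i => X i - x' i))
        - 8 * nproj v (alive x :\ p) (th j) + (K j + d * dot (th j) w))
      <= Phi (x' p).
  exists X => //; apply: le_trans (_ : Phi (x' p) <= _); last by rewrite x'p.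
  apply: le_trans HX; rewrite le_eqVlt; apply/orP; left; apply/eqP.
  apply: eq_bigr => j _; rewrite combX dotDr dotZr; congr (_ * expR _); ring.
have [IHr IHp] := IH x' xb' cA.
(* While [p] stays alive, the residual gains an orthogonal component [z]; its
   share of the exponent is paid for by the decrease of [nproj], and convexity of
   [exp] merges it into [sp], [sm] with weight [|z|^2]. *)
have [pA'|pA'] := boolP (p \in alive x').
  pose w' := pivot_dir x' p; pose z := w' - w.
  have w'E : w' = w + z by rewrite addrC subrK.
  have sA1 : alive x' :\ p \subset alive x :\ p by apply: setSD.
  have zE : z = proj v (alive x :\ p) (v p) - proj v (alive x' :\ p) (v p).
    by rewrite /z /w' /w /pivot_dir opprB addrC addrA subrK.
  have zspan : in_span v (alive x :\ p) z.
    rewrite zE; apply: in_spanB; first exact: proj_span.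
    exact: in_spanS sA1 (proj_span _ _ _).
  have zorth : orth v (alive x' :\ p) z.
    by apply: orthB; [exact: pivot_dir_orth|exact: orthS sA1 (@pivot_dir_orth x p)].
  have wz : dot w z = 0 := orth_in_span (@pivot_dir_orth x p) zspan.
  have Q'E : dot w' w' = dot w w + dot z z.
    by rewrite w'E dotDD wz mulr0 addr0.
  have z0 := dot_ge0 z.
  pose y j := dot (th j) z / dot z z.
  have ay j : dot (th j) z = dot z z * y j.
    have [e0|e0] := eqVneq (dot z z) 0; last by rewrite mulrC divfK.
    by rewrite e0 mul0r (dot_eq0 e0) dotC dot0l.
  have a'E j : dot (th j) w' = dot (th j) w + dot z z * y j by rewrite w'E dotDr ay.
  pose k (e : R) j := - 8 * y j ^+ 2 + y j * (e - x' p).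
  pose K' j := K j + d * dot (th j) w - 8 * (dot z z * y j ^+ 2).
  have Hk (s : J -> R) e :
      (forall j t, expR t * (dot w w + (K j + dot (th j) w * (e - x p)) - dot w w * t) <= s j) ->
      forall j t, expR t * (dot w' w' + (K' j + dot (th j) w' * (e - x' p)) - dot w' w' * t)
        <= s j + dot z z * expR (k e j).
    move=> Hs j t.
    rewrite (_ : expR t * _ =
       expR t * (dot w w + (K j + dot (th j) w * (e - x p)) - dot w w * t)
       + dot z z * (expR t * (1 + k e j - t))); last first.
      by rewrite Q'E a'E /K' /k x'p; ring.
    by rewrite lerD // ler_wpM2l // expR_tangent.
  have [X Xs HX] := IHp p pA' W _ _ K' W0 (Hk _ _ Hp) (Hk _ _ Hm).
  exists X => //; apply: le_trans (le_trans HX _).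
    apply: ler_sum => j _; rewrite ler_wpM2l // ler_expR.
    have := dot_sq_le_nproj (th j) sA1 zspan zorth; rewrite ay => h.
    suff : dot z z * y j ^+ 2 <= nproj v (alive x :\ p) (th j) - nproj v (alive x' :\ p) (th j).
      by rewrite /K'; lra.
    have [e0|e0] := eqVneq (dot z z) 0.
      by rewrite e0 mul0r subr_ge0 nproj_mono.
    have ep : 0 < dot z z by rewrite lt_def e0.
    by rewrite -(ler_pM2l ep); apply: le_trans h; rewrite mulrA -expr2 -exprMn.
  apply: ler_sum => j _; rewrite ler_wpM2l //.
  have := xb' p; rewrite ler_norml => /andP[x1 x2].
  rewrite -[pivot_dir x' p]/w' Q'E.
  have := ler_wpM2l (expR_ge0 (- 8 * y j ^+ 2)) (two_point_mgf (y j) x1 x2).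
  rewrite -expRD (_ : _ + 8 * _ = 0); last by ring.
  rewrite expR0 mulrDr => h.
  have {}h : (1 + x' p) / 2 * expR (k 1 j) + (1 - x' p) / 2 * expR (k (-1) j) <= 1.
    apply: le_trans h; rewrite /k !expRD.
    by move: (expR _) (expR _) (expR _) => A B C; lra.
  have := ler_wpM2l z0 h.
  by move: (expR _) (expR _) => A B; lra.
(* Here the pivot is frozen: the accumulated exponent joins the weights, and [roundable] applies at
   [x']. *)
pose W' j := W j * expR (K j + d * dot (th j) w - 8 * nproj v (alive x :\ p) (th j)).
have W'0 j : 0 <= W' j by rewrite mulr_ge0 ?expR_ge0.
have [X Xs HX] := IHr W' W'0; exists X => //.
have sAp : alive x' \subset alive x :\ p by rewrite subsetD1 sA.
(* With [T] the exponent and [Q = dot w w], this is the convexity bound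
   [exp T <= Q exp (T / Q) + (1 - Q)], with [s] dominating the first term; both terms are used
   through tangents at [T]. *)
have endpoint (s : J -> R) e : x' p = e ->
    (forall j t, expR t * (dot w w + (K j + dot (th j) w * (e - x p)) - dot w w * t) <= s j) ->
    forall j, expR (K j + d * dot (th j) w) <= s j + 1 - dot w w.
  move=> xe Hs j.
  have -> : K j + d * dot (th j) w = K j + dot (th j) w * (e - x p).
    by rewrite -xe x'p addrAC subrr add0r mulrC.
  have := Hs j (K j + dot (th j) w * (e - x p)).
  have := expR_tangent (K j + dot (th j) w * (e - x p)) 0; rewrite expR0.
  move: (K j + _) => t; move: (expR t) (dot w w) Q1 Q0 (s j) => E Q Q1' Q0' sj h1 h2.
  have : 0 <= 1 - Q by lra.
  move/ler_wpM2l => /(_ _ _ h1); lra.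
have {endpoint} Hend j : expR (K j + d * dot (th j) w)
    <= (1 + x' p) / 2 * sp j + (1 - x' p) / 2 * sm j + 1 - dot w w.
  move: pA'; rewrite inE negbK sqrf_eq1 => /orP[] /eqP xe; rewrite xe.
    by have := endpoint _ _ xe Hp j; lra.
  by have := endpoint _ _ xe Hm j; lra.
have WE j : W j * expR (dot (th j) (comb (fun i => X i - x' i))
        - 8 * nproj v (alive x :\ p) (th j) + (K j + d * dot (th j) w)) =
    W' j * expR (dot (th j) (comb (fun i => X i - x' i))).
  by rewrite /W' -mulrA -expRD; congr (_ * expR _); ring.
rewrite (eq_bigr _ (fun j _ => WE j)); apply: le_trans HX _.
apply: ler_sum => j _; rewrite /W' -mulrA -expRD ler_wpM2l //.
apply: le_trans (Hend j); rewrite ler_expR.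
by have := nproj_mono v (th j) sAp; lra.
Qed.

(** Both statements go together, by induction on the number of alive coordinates; with none alive,
    [x] itself is a sign vector. *)
Lemma all_roundable x : (forall i, `|x i| <= 1) -> roundable x.
Proof.
move=> xb; suff [] : roundable x /\ forall p, p \in alive x -> roundable_pivot x p by [].
move: {2}#|alive x| (leqnn #|alive x|) => n; elim: n x xb => [|n IH] x xb An.
  have A0 : alive x = set0 by apply/eqP; rewrite -cards_eq0 -leqn0.
  split=> [W W0|p]; last by rewrite A0 inE.
  exists x.
    by move=> i; have : i \notin alive x by [rewrite A0 inE];
       rewrite inE negbK sqrf_eq1 => /orP[] /eqP; [left|right].
  apply: ler_sum => j _; rewrite ler_wpM2l // ler_expR combB subrr dotC dot0l.
  by rewrite mulr_ge0 ?nproj_ge0.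
have Hp p : p \in alive x -> roundable_pivot x p.
  move=> pA; apply: roundable_pivot_step => // y yb yA; apply: IH => //.
  by rewrite -ltnS (leq_trans yA).
split=> //; have [A0|[p pA]] := set_0Vmem (alive x); last first.
  exact: roundable_of_pivot pA (xb p) (Hp p pA).
by apply: (IH x xb _).1; rewrite A0 cards0.
Qed.

(** The walk is started at the centre of the cube, and [nproj] is bounded by the full squared
    norm. *)
Theorem gram_schmidt_balancing W : (forall j, 0 <= W j) ->
  exists2 X, is_sign X &
    \sum_j W j * expR (dot (th j) (comb X))
      <= \sum_j W j * expR (8 * dot (th j) (th j)).
Proof.
move=> W0; have [|X Xs HX] := @all_roundable (fun=> 0) _ W W0.
  by move=> i; rewrite normr0.
exists X => //; move: HX; under eq_bigr do under [comb _]eq_bigr do rewrite subr0.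
move/le_trans; apply; apply: ler_sum => j _; rewrite ler_wpM2l // ler_expR.
by rewrite ler_pM2l ?nproj_le.
Qed.

End GramSchmidtWalk.

(** * The lower bound *)

Section Points.
Variables (d : nat) (N : 'I_d -> nat).
Implicit Types (x y : Omega N) (p q b : 'I_d -> int).

Lemma card_Omega : #|Omega N| = (\prod_(e < d) N e)%N.
Proof.
by rewrite card_dep_ffun foldrE big_image; apply: eq_bigr => e _; rewrite card_ord.
Qed.

(** Coordinates start at 0 here, while those of [pt] start at 1. The position [p] may lie outside
    the box. *)
Definition at_point x p := [forall e, (x e)%:Z == p e].

Lemma at_pointP x p : reflect (forall e, (x e)%:Z = p e) (at_point x p).
Proof. by apply: (iffP forallP) => h e; apply/eqP. Qed.

Lemma at_point_inj x y p : at_point x p -> at_point y p -> x = y.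
Proof.
move=> /at_pointP xp /at_pointP yp; apply/ffunP => e; apply: val_inj => /=.
by apply/eqP; rewrite -eqz_nat xp yp.
Qed.

Lemma exists_at_point p : (forall e, 0 <= p e /\ p e < (N e)%:Z) ->
  exists x, at_point x p.
Proof.
move=> pN; have lt e : (`|p e| < N e)%N by have := pN e; lia.
exists [ffun e => Ordinal (lt e)]; apply/at_pointP => e; rewrite ffunE /=.
by have := pN e; lia.
Qed.

Lemma at_point_bounds x p e : at_point x p -> 0 <= p e /\ p e < (N e)%:Z.
Proof. by move=> /at_pointP <-; have := ltn_ord (x e); lia. Qed.

Definition line p b (k : int) : 'I_d -> int := fun e => p e + k * b e.

Lemma line_between p b (i j k : int) : i <= j -> j <= k ->
  (exists x, at_point x (line p b i)) -> (exists x, at_point x (line p b k)) ->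
  exists x, at_point x (line p b j).
Proof.
move=> ij jk [x xi] [y yk]; apply: exists_at_point => e.
have := at_point_bounds e xi; have := at_point_bounds e yk; rewrite /line.
by have [b0|b0] := lerP 0 (b e); nia.
Qed.

Lemma line_inj x p b (j k : int) : (exists e, b e != 0) ->
  at_point x (line p b j) -> at_point x (line p b k) -> j = k.
Proof.
move=> [e be] /at_pointP/(_ e) + /at_pointP/(_ e); rewrite /line => -> h.
have {}h : (j - k) * b e = 0 by lia.
by move/eqP: h; rewrite mulf_eq0 (negPf be) orbF subr_eq0 => /eqP.
Qed.

Definition opt x : 'I_d -> int := fun e => (x e)%:Z.

End Points.

Section SetOnLine.
Variables (d : nat) (N : 'I_d -> nat) (chi : {ffun Omega N -> bool}) (D : nat).
Hypothesis chiD : forall A, is_AP A -> (`|chi_sum chi A| <= D)%N.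

Implicit Types (p b : 'I_d -> int) (x : Omega N).

Definition sgc (x : Omega N) : int := if chi x then 1 else -1.

(** The colouring extended by 0 outside the box: the sum has at most one term. *)
Definition ext (p : 'I_d -> int) : int := \sum_(x | at_point x p) sgc x.

(** By convexity, the part of the segment inside the box is again a progression, or is empty and
    contributes 0. *)
Lemma ext_line_bound p b l : (exists e, b e != 0) ->
  (absz (\sum_(j < l) ext (line p b j))%R <= D)%N.
Proof.
move=> b0.
pose A := [set x : Omega N | [exists j : 'I_l, at_point x (line p b j)]].
have -> : \sum_(j < l) ext (line p b j) = chi_sum chi A.
  rewrite /ext (exchange_big_dep (mem A)) /=.
    apply: eq_bigr => x; rewrite inE => /existsP[j xj].
    rewrite (big_pred1 j) // => k; apply/idP/eqP => [xk|-> //].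
    by apply/val_inj/eqP; rewrite -eqz_nat; apply/eqP/(line_inj b0 xk xj).
  by move=> j x _ xj; rewrite inE; apply/existsP; exists j.
have [->|[x0]] := set_0Vmem A; first by rewrite /chi_sum big_set0.
rewrite inE => /existsP[i0 x0i].
pose J (j : 'I_l) := [exists x : Omega N, at_point x (line p b j)].
have J0 : J i0 by apply/existsP; exists x0.
apply: chiD; case: (arg_minnP (fun j : 'I_l => val j) J0) => j0 Jj0 minj.
case: (arg_maxnP (fun j : 'I_l => val j) J0) => j1 Jj1 maxj.
have j01 : (j0 <= j1)%N by apply: leq_trans (maxj _ J0); apply: minj.
(* From the least to the greatest index inside the box; the [+ 1] converts to the coordinates of
   [pt]. *)
exists (fun e => line p b j0 e + 1), b, (j1 - j0).+1; split=> //.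
have lineD k f : line p b j0 f + 1 + k%:Z * b f = line p b (j0 + k)%N f + 1.
  by rewrite /line; lia.
split=> //; split=> [k kl f|x].
  rewrite lineD.
  have [x xk] : exists x : Omega N, at_point x (line p b (j0 + k)%N).
    by apply: (@line_between _ _ _ _ j0 _ j1); [lia|lia|exact/existsP|exact/existsP].
  by have := at_point_bounds f xk; lia.
rewrite inE; split=> [/existsP[j xj]|[k kl xk]].
  have Jj : J j by apply/existsP; exists x.
  have := minj _ Jj; have /= := maxj _ Jj => jm mj.
  exists (j - j0)%N => [|f]; first by lia.
  by rewrite lineD subnKC // /pt; move/at_pointP: xj => ->.
have kl' : (j0 + k < l)%N by have := ltn_ord j1; lia.
apply/existsP; exists (Ordinal kl'); apply/at_pointP => f /=.
by have := xk f; rewrite lineD /pt => /addIr.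
Qed.

(** Through [bpt], base points from [- N e] to [2 * N e - 1]: enough to contain every translate of
    the box by entries at most [N e] in size. *)
Definition big_box := Omega (fun e => 3 * N e)%N.
Definition bpt (a : big_box) : 'I_d -> int := fun e => (a e)%:Z - (N e)%:Z.

Lemma ext_opt x : ext (opt x) = sgc x.
Proof.
rewrite /ext (big_pred1 x) // => y; apply/idP/eqP => [yx|->]; last exact/at_pointP.
by apply: at_point_inj yx _; apply/at_pointP.
Qed.

(** Each [x] equals [bpt a + u] for exactly one base point [a], so only the difference [v - u]
    matters. *)
Lemma shift_correlation (u v : 'I_d -> int) : (forall e, `|u e| <= (N e)%:Z) ->
  \sum_a ext (fun e => bpt a e + u e) * ext (fun e => bpt a e + v e) =
  \sum_x sgc x * ext (fun e => opt x e - u e + v e).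
Proof.
move=> uN; under eq_bigr do rewrite mulr_suml.
rewrite (exchange_big_dep predT) //=; apply: eq_bigr => x _.
have [a xa] : exists a : big_box, at_point a (fun e => opt x e - u e + (N e)%:Z).
  by apply: exists_at_point => e; rewrite /opt; have := uN e; case: (x e) => k kN /=; lia.
rewrite (big_pred1 a) => [|c].
  congr (_ * ext _); apply/funext => e; rewrite /bpt.
  by move/at_pointP: xa => ->; rewrite addrK.
apply/idP/eqP => [/at_pointP xc|->]; last first.
  by apply/at_pointP => e; rewrite /bpt; move/at_pointP: xa => ->; rewrite /opt; lia.
apply: at_point_inj xa; apply/at_pointP => e; rewrite /opt xc /bpt; lia.
Qed.

Lemma sum_square_correlation (K : finType) (w : K -> 'I_d -> int) :
  (forall k e, `|w k e| <= (N e)%:Z) ->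
  \sum_a (\sum_k ext (fun e => bpt a e + w k e)) ^+ 2 =
  \sum_k \sum_k' \sum_x sgc x * ext (fun e => opt x e - w k e + w k' e).
Proof.
move=> wN; under eq_bigr do rewrite expr2 big_distrlr /=.
rewrite exchange_big; apply: eq_bigr => k _.
rewrite exchange_big; apply: eq_bigr => k' _.
exact: shift_correlation.
Qed.

Lemma correlation0 : \sum_x sgc x * ext (opt x) = #|Omega N|%:Z.
Proof.
rewrite (eq_bigr (fun=> 1)) => [|x _]; first by rewrite sumr_const natz.
by rewrite ext_opt /sgc; case: (chi x).
Qed.

Lemma sum_int_const (K : finType) (c : int) : \sum_(k : K) c = #|K|%:Z * c.
Proof. by rewrite sumr_const -mulr_natl natz. Qed.

Lemma exchange_big3 (I J K : finType) (F : I -> J -> K -> int) :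
  \sum_i \sum_j \sum_k F i j k = \sum_k \sum_i \sum_j F i j k.
Proof.
rewrite [RHS]exchange_big; apply: eq_bigr => i _.
exact: exchange_big.
Qed.

(** Double counting yields [l B <= l^2 + 3^d B D^2] with [B] the size of [Omega tau], and [2 l <= B]
    absorbs [l^2]. The factor [3^d] counts base points per point of the box. *)
Lemma disc_lower_aux (tau : 'I_d -> nat) (l : nat) : (0 < #|Omega N|)%N ->
  (forall e, (l * (tau e).-1 <= N e)%N) -> (2 * l <= #|Omega tau|)%N ->
  (l <= 2 * 3 ^ d * D ^ 2)%N.
Proof.
move=> N0 ltau lB; have [->//|l0] := posnP l.
have bound (j c : int) e : `|j| <= l%:Z -> `|c| <= (tau e).-1%:Z -> `|j * c| <= (N e)%:Z.
  move=> jl ce; rewrite normrM.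
  apply: le_trans (_ : l%:Z * (tau e).-1%:Z <= _); first by rewrite ler_pM.
  by rewrite -PoszM lez_nat.
pose w (b b' : Omega tau) (j : 'I_l) e := j%:Z * ((b e)%:Z - (b' e)%:Z).
have wN (b b' : Omega tau) j e : `|w b b' j e| <= (N e)%:Z.
  apply: bound; first by have := ltn_ord j; lia.
  by case: (b e) (b' e) => k kb [k' kb'] /=; lia.
pose S (b b' : Omega tau) := \sum_a (\sum_j ext (fun e => bpt a e + w b b' j e)) ^+ 2.
pose P := #|Omega N|%:Z; pose B := #|Omega tau|%:Z; pose D2 := D%:Z ^+ 2.
(* For [b = b'] the difference is 0 and there is no progression; these terms are computed
   exactly. *)
have Sdiag (b : Omega tau) : S b b = l%:Z ^+ 2 * P.
  rewrite /S sum_square_correlation; last exact: wN.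
  rewrite (eq_bigr (fun=> l%:Z * P)) => [|j _].
    by rewrite sumr_const card_ord -mulr_natl natz expr2 mulrA.
  rewrite (eq_bigr (fun=> P)) => [|j' _].
    by rewrite sumr_const card_ord -mulr_natl natz.
  rewrite /P -correlation0; apply: eq_bigr => x _; congr (_ * ext _).
  by apply/funext => e; rewrite /w subrr !mulr0 subr0 addr0.
have Soff (b b' : Omega tau) : b != b' -> S b b' <= 3 ^+ d * P * D2.
  move=> bb'; have [e be] : exists e, (b e)%:Z - (b' e)%:Z != 0.
    apply/existsP; apply: contraR bb'; rewrite negb_exists => /forallP h.
    apply/eqP/ffunP => e; apply: val_inj; have := h e; rewrite negbK subr_eq0.
    by rewrite eqz_nat => /eqP.
  apply: le_trans (_ : \sum_(a : big_box) D2 <= _).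
    apply: ler_sum => a _.
    have := @ext_line_bound (bpt a) (fun e => (b e)%:Z - (b' e)%:Z) l (ex_intro _ e be).
    rewrite /D2 -[X in _ -> X ^+ 2 <= _]/(\sum_(j < l) ext (line (bpt a) (fun e => (b e)%:Z - (b' e)%:Z) j)).
    by move: (\sum_(j < l) _) => z; nia.
  rewrite sumr_const card_Omega big_split /= prod_nat_const card_ord -card_Omega.
  by rewrite -[D2 *+ _]mulr_natl natz PoszM /P -natz natrX.
(* The shift [(j' - j)(b - b')] is symmetric in the two pairs, so indices and differences can
   exchange roles. *)
have SE : \sum_(b : Omega tau) \sum_(b' : Omega tau) S b b' = \sum_(j < l) \sum_(j' < l)
    \sum_a (\sum_(b : Omega tau) ext (fun e => bpt a e + (j%:Z - j'%:Z) * (b e)%:Z)) ^+ 2.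
  under eq_bigr do under eq_bigr do rewrite /S sum_square_correlation //.
  rewrite exchange_big3; apply: eq_bigr => j _.
  rewrite exchange_big3; apply: eq_bigr => j' _.
  rewrite sum_square_correlation => [|b e]; last first.
    apply: bound; first by have := ltn_ord j; have := ltn_ord j'; lia.
    by case: (b e) => k kb /=; lia.
  apply: eq_bigr => b _; apply: eq_bigr => b' _; apply: eq_bigr => x _.
  by congr (_ * ext _); apply/funext => e; rewrite /w; ring.
have ext2 : \sum_a ext (bpt a) ^+ 2 = P.
  have h : forall e, `|(fun=> 0 : int) e| <= (N e)%:Z by move=> e; rewrite normr0.
  have := shift_correlation (fun=> 0) h.
  under eq_bigr do rewrite -expr2; under [RHS]eq_bigr do under eq_fun do rewrite subr0 addr0.
  by under eq_bigr do under eq_fun do rewrite addr0; rewrite correlation0 => ->.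
have SL : l%:Z * (B ^+ 2 * P) <= \sum_(b : Omega tau) \sum_(b' : Omega tau) S b b'.
  rewrite SE -[l in l%:Z]card_ord -natz mulr_natl -sumr_const.
  apply: ler_sum => j _; rewrite (bigD1 j) //= -ext2 mulr_sumr.
  rewrite -[leLHS]addr0; apply: lerD; last first.
    by apply: sumr_ge0 => j' _; apply: sumr_ge0 => a _; apply: sqr_ge0.
  apply: ler_sum => a _.
  under [X in _ <= X ^+ 2]eq_bigr do under eq_fun do rewrite subrr mul0r addr0.
  by rewrite sumr_const -mulr_natl natz exprMn.
have SU : \sum_(b : Omega tau) \sum_(b' : Omega tau) S b b'
    <= B * (l%:Z ^+ 2 * P + B * (3 ^+ d * P * D2)).
  have -> : B * (l%:Z ^+ 2 * P + B * (3 ^+ d * P * D2)) =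
     \sum_(b : Omega tau) (l%:Z ^+ 2 * P + \sum_(b' : Omega tau) 3 ^+ d * P * D2).
    by rewrite !sum_int_const.
  apply: ler_sum => b _; rewrite (bigD1 b) //= Sdiag lerD2l.
  rewrite [leRHS](bigD1 b) //= -[leLHS]add0r; apply: lerD.
    by rewrite !mulr_ge0 ?exprn_ge0.
  by apply: ler_sum => b' bb'; apply: Soff; rewrite eq_sym.
have P0 : 0 < P by rewrite /P; lia.
have B0 : 0 < B by rewrite /B; lia.
have lB' : 2 * l%:Z <= B by rewrite /B; lia.
have main := le_trans SL SU.
have {}main : l%:Z * B <= l%:Z ^+ 2 + B * (3 ^+ d * D2).
  have BP : 0 < B * P by rewrite mulr_gt0.
  rewrite -(ler_pM2l BP); move: main; congr (_ <= _); ring.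
have {main} : l%:Z <= 2 * (3 ^+ d * D2).
  rewrite -(ler_pM2l B0); nia.
rewrite /D2 -lez_nat !PoszM -!natz !natrX !natz; lia.
Qed.
End SetOnLine.

(** * From single colourings to the discrepancy *)

Section DiscBounds.
Variables (d : nat) (N : 'I_d -> nat).

Lemma disc_lower (tau : 'I_d -> nat) (l : nat) : (0 < #|Omega N|)%N ->
  (forall e, (l * (tau e).-1 <= N e)%N) -> (2 * l <= #|Omega tau|)%N ->
  (l <= 2 * 3 ^ d * disc N ^ 2)%N.
Proof.
move=> N0 ltau lB.
have chi_lower (chi : {ffun Omega N -> bool}) D :
    (forall A, is_AP A -> (`|chi_sum chi A| <= D)%N) -> (l <= 2 * 3 ^ d * D ^ 2)%N.
  by move=> chiD; apply: (disc_lower_aux chiD N0 ltau lB).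
rewrite /disc; apply: (big_ind (fun D => l <= 2 * 3 ^ d * D ^ 2)%N) => [|D D' h h'|chi _].
(* The default value of the minimum satisfies the bound too: it dominates all sums of a constant
   colouring. *)
- apply: (chi_lower [ffun=> true]) => A _; rewrite /chi_sum.
  under eq_bigr do rewrite ffunE.
  by rewrite sumr_const natz; apply: max_card.
- by rewrite /minn; case: ifP.
- apply: (chi_lower chi) => A AP.
  by apply: (@leq_bigmax_cond _ _ (fun A => `|chi_sum chi A|%N) A); apply/asboolP.
Qed.

Lemma disc_le (chi : {ffun Omega N -> bool}) (D : nat) :
  (forall A, is_AP A -> (`|chi_sum chi A| <= D)%N) -> (disc N <= D)%N.
Proof.
move=> chiD; rewrite /disc.
have : chi \in index_enum {ffun Omega N -> bool} by rewrite mem_index_enum.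
elim: (index_enum _) => // c s IH; rewrite inE big_cons geq_min => /orP[/eqP <-|/IH ->].
  by apply/orP; left; apply/bigmax_leqP => A /asboolP; apply: chiD.
by rewrite orbT.
Qed.

End DiscBounds.

Section LowerBound.
Variables (R : realType) (d : nat) (N : 'I_d -> nat).
Hypothesis N_gt0 : forall i, (0 < N i)%N.

Definition Mterm (I : {set 'I_d}) : R :=
  ((\prod_(i in I) N i)%N)%:R `^ (1 / ((2 * #|I| + 2)%N)%:R).

Lemma prodN_gt0 (I : {set 'I_d}) : (0 < \prod_(i in I) N i)%N.
Proof. by apply: prodn_gt0. Qed.

Lemma Mterm_gt0 I : 0 < Mterm I.
Proof. by rewrite powR_gt0 // ltr0n prodN_gt0. Qed.

Lemma Mterm_pow I : (Mterm I ^+ 2) ^+ #|I|.+1 = (\prod_(i in I) N i)%N%:R.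
Proof.
rewrite -exprM -powR_mulrn ?ltW ?Mterm_gt0 // -powRrM.
rewrite (_ : (2 * #|I|.+1)%N = (2 * #|I| + 2)%N); last by rewrite mulnS addnC.
by rewrite div1r mulVf ?powRr1 ?pnatr_eq0 ?addn2.
Qed.

(** The case [l = 1] with a two-point box [tau]; it serves the range where [L] is too small to be
    rounded. *)
Lemma disc_gt0 : (1 < \prod_(i < d) N i)%N -> (0 < disc N)%N.
Proof.
move=> N1; have [e Ne] : exists e, (1 < N e)%N.
  apply/existsP; apply: contraTT N1; rewrite negb_exists -leqNgt => /forallP h.
  by rewrite big1 // => i _; apply/eqP; rewrite eqn_leq N_gt0 andbT leqNgt.
have N0 : (0 < #|Omega N|)%N by rewrite card_Omega prodn_gt0.
rewrite lt0n; apply/eqP => D0.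
have : (1 <= 2 * 3 ^ d * disc N ^ 2)%N; last by rewrite D0 muln0.
apply: (@disc_lower _ _ (fun i => if i == e then 2 else 1)) => // [i|].
  by case: eqP => [->|]; rewrite ?mul1n //= ltnW.
rewrite card_Omega (bigD1 e) //= eqxx big1 // => i /negPf ->; by [].
Qed.

Lemma Mterm_le_disc I : (1 < \prod_(i < d) N i)%N ->
  Mterm I <= (8 * 3 ^ d * disc N)%N%:R.
Proof.
move=> N1; have D0 := disc_gt0 N1; set m := Mterm I; have m0 : 0 < m := Mterm_gt0 I.
have C1 : (1 <= 3 ^ d)%N by rewrite expn_gt0.
have [L2|L2] := ltP (m ^+ 2) 2.
  apply: le_trans (_ : 2%:R <= _); first by nra.
  by rewrite ler_nat; nia.
pose L := m ^+ 2; have L0 : 0 < L by rewrite exprn_gt0.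
pose l := Num.truncn (L / 2).
have /andP[l1 l2] : (l%:R <= L / 2 < l.+1%:R) by apply: truncn_itv; rewrite divr_ge0 // ltW.
(* The floor plus 1 is at least [N e / L], so [Omega tau] has at least [L^(|I|+1) / L^|I| = L]
   points, while [l * (tau e).-1] stays below [N e]. *)
pose tau e := if e \in I then (Num.truncn ((N e)%:R / L)).+1 else 1%N.
have tauE e : e \in I -> (tau e).-1%:R <= (N e)%:R / L /\ (N e)%:R / L <= (tau e)%:R.
  move=> eI; rewrite /tau eI.
  have /andP[h1 h2] : (Num.truncn ((N e)%:R / L))%:R <= (N e)%:R / L < (Num.truncn ((N e)%:R / L)).+1%:R.
    by apply: truncn_itv; rewrite divr_ge0 // ltW.
  by split=> //; apply: ltW.
have N0 : (0 < #|Omega N|)%N by rewrite card_Omega prodn_gt0.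
have h : (l <= 2 * 3 ^ d * disc N ^ 2)%N.
  apply: (disc_lower (tau := tau)) => // [e|].
    have [eI|eI] := boolP (e \in I); last by rewrite /tau (negPf eI) muln0.
    rewrite -(ler_nat R) natrM; have [h1 _] := tauE e eI.
    apply: le_trans (ler_pM _ _ l1 h1) _ => //.
    rewrite (_ : L / 2 * _ = (N e)%:R / 2); last by field; rewrite gt_eqF.
    by have : 0 <= (N e)%:R :> R by []; lra.
  rewrite card_Omega -(ler_nat R) natrM; apply: le_trans (_ : L <= _); first by lra.
  rewrite natr_prod (bigID (mem I)) /= [X in _ * X]big1 ?mulr1; last first.
    by move=> e /negPf eI; rewrite /tau eI.
  apply: le_trans (_ : \prod_(e in I) ((N e)%:R / L) <= _); last first.
    apply: ler_prod => e eI; rewrite divr_ge0 ?(ltW L0) //=.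
    by have [] := tauE e eI.
  rewrite big_split /= prodr_const -natr_prod -Mterm_pow -/m -/L exprS.
  by rewrite -mulrA -exprMn divff ?expr1n ?mulr1 // gt_eqF.
have {}h : m ^+ 2 <= (8 * 3 ^ d * disc N ^ 2)%N%:R.
  have : (1 : R) <= l%:R.
    by rewrite ler1n lt0n; apply/eqP => l0; move: l2; rewrite l0; rewrite /L; lra.
  move: l2; rewrite -[l.+1]addn1 natrD => l2 l3.
  (* From [L / 2 < l + 1] and [1 <= l]. *)
  apply: le_trans (_ : 4 * l%:R <= _); first by rewrite -/L; lra.
  rewrite (_ : 8 * 3 ^ d * disc N ^ 2 = 4 * (2 * 3 ^ d * disc N ^ 2))%N; last by ring.
  by rewrite natrM ler_pM2l // ler_nat.
rewrite -ler_sqr ?nnegrE ?(ltW m0) //; apply: le_trans h _.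
rewrite -natrX ler_nat; move: (8 * 3 ^ d)%N (muln_gt0 8 (3 ^ d)) => c; rewrite C1 /= => c0.
by rewrite expnMn leq_mul2r -(mulnn c) leq_pmulr ?c0 ?orbT.
Qed.

Lemma Mfac_le_disc : (1 < \prod_(i < d) N i)%N ->
  Mfac R N <= (8 * 3 ^ d * disc N)%N%:R.
Proof. by move=> N1; apply: bigmax_le => // I _; apply: Mterm_le_disc. Qed.

End LowerBound.

(** * Aligned blocks on lines in the box *)

Section Blocks.
Variables (d : nat) (N : 'I_d -> nat).
Implicit Types (x y z r : Omega N) (b : 'I_d -> int).

Lemma line_opt x y b (i j : int) : at_point y (line (opt x) b i) ->
  line (opt y) b j = line (opt x) b (i + j).
Proof.
by move=> /at_pointP yi; apply/funext => e; rewrite {1}/line /opt yi /line; ring.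
Qed.

Lemma line_back x y b (i : int) :
  at_point y (line (opt x) b i) -> at_point x (line (opt y) b (- i)).
Proof.
move=> yi; rewrite (line_opt _ yi) subrr; apply/at_pointP => e.
by rewrite /line mul0r addr0.
Qed.

Definition is_root b r := forall x, ~~ at_point x (line (opt r) b (-1)).

Lemma root_first b r x (k : int) : is_root b r -> at_point x (line (opt r) b k) -> 0 <= k.
Proof.
move=> rr xk; rewrite leNgt; apply/negP => k0.
have r0 : exists y, at_point y (line (opt r) b 0).
  by exists r; apply/at_pointP => e; rewrite /line mul0r addr0.
have k1 : k <= -1 by lia.
have [//|y yr] := line_between k1 _ (ex_intro _ x xk) r0.
by move: (rr y); rewrite yr.
Qed.

(** Step back from [x] as far as the box allows; a coordinate with [b e != 0] bounds the number of
    steps. *)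
Lemma root_exists b x : (exists e, b e != 0) ->
  exists r n, [/\ is_root b r, at_point x (line (opt r) b n%:Z) & exists e, (n < N e)%N].
Proof.
move=> b0; have [e be] := b0.
pose P (n : nat) := [exists r : Omega N, at_point r (line (opt x) b (- n%:Z))].
have P0 : exists n, P n.
  by exists 0%N; apply/existsP; exists x; apply/at_pointP => f; rewrite /line mul0r addr0.
have Pb n : P n -> (n <= (N e).-1)%N.
  move=> /existsP[r /at_pointP/(_ e)]; rewrite /line /opt.
  case: (x e) (r e) => k kN [k' k'N] /= h.
  have : `|n%:Z * b e| <= (N e).-1%:Z by lia.
  rewrite normrM; have : 1 <= `|b e| by lia.
  nia.
case: (ex_maxnP P0 Pb) => n Pn nmax; have := Pn => /existsP[r rn].
exists r, n; split.
- move=> y; apply/negP => yr; have : P n.+1.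
    apply/existsP; exists y; move: yr; rewrite (line_opt _ rn).
    by rewrite (_ : - n%:Z + -1 = - n.+1%:Z) //; lia.
  by move/nmax; rewrite ltnn.
- by have := line_back rn; rewrite opprK.
- by exists e; have := Pb n Pn; case: (x e) => k kN; lia.
Qed.

Definition seg r b (m n : nat) x := [exists j : 'I_n, at_point x (line (opt r) b (m + j)%N)].

Lemma segP r b m n x : reflect (exists2 j : nat, (j < n)%N & at_point x (line (opt r) b (m + j)%N))
  (seg r b m n x).
Proof.
apply: (iffP existsP) => [[j xj]|[j jn xj]]; first by exists j.
by exists (Ordinal jn).
Qed.

(** An equality of numbers, so that indicators can be added; disjointness comes from [line_inj]. *)
Lemma seg_split r b m n n' x : (exists e, b e != 0) ->
  seg r b m (n + n') x = (seg r b m n x + seg r b (m + n) n' x)%N :> nat.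
Proof.
move=> b0; case: (segP r b m n x) => [[j jn xj]|h1].
  have -> : seg r b m (n + n') x by apply/segP; exists j => //; lia.
  case: (segP r b (m + n) n' x) => // -[k kn xk].
  by have := line_inj b0 xj xk; lia.
case: (segP r b (m + n) n' x) => [[j jn xj]|h2].
  have -> // : seg r b m (n + n') x.
  by apply/segP; exists (n + j)%N; rewrite ?addnA //; lia.
case: (segP r b m (n + n') x) => // -[j jn xj].
have [jn'|jn'] := ltnP j n; first by case: h1; exists j.
by case: h2; exists (j - n)%N; [lia|rewrite -addnA subnKC].
Qed.

Lemma card_seg r b m n : (exists e, b e != 0) -> (#|[set x | seg r b m n x]| <= n)%N.
Proof.
move=> b0; elim: n => [|n IH].
  by rewrite leqn0 cards_eq0; apply/eqP/setP => x; rewrite !inE; apply/segP => -[].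
have : [set x | seg r b m n.+1 x] \subset [set x | seg r b m n x] :|:
    [set x | at_point x (line (opt r) b (m + n)%N)].
  apply/subsetP => x; rewrite !inE => /segP[j]; rewrite ltnS leq_eqVlt => /orP[/eqP ->|jn] xj.
    by rewrite xj orbT.
  by apply/orP; left; apply/segP; exists j.
move/subset_leq_card/leq_trans; apply; apply: leq_trans (leq_card_setU _ _) _.
rewrite -addn1 leq_add //; apply/card_le1P => x; rewrite inE => xn y; rewrite !inE.
apply/idP/eqP => [yn|-> //]; exact: at_point_inj yn xn.
Qed.

(* Alignment is relative to the first point [r] of the line inside the box, so
   that the blocks cutting a prefix never leave the box. *)
Definition block_start (s : nat) b y :=
  (exists e, b e != 0) /\
  exists r q, [/\ is_root b r, at_point y (line (opt r) b (q * s)%N)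
    & exists z, at_point z (line (opt y) b s.-1)].

Definition in_block s b y x := seg y b 0 s x.

(** The first point of the line in the box fixes the index of [x], and Euclidean division by [s]
    then fixes the block. *)
Lemma block_unique s b x y y' : block_start s b y -> block_start s b y' ->
  in_block s b y x -> in_block s b y' x -> y = y'.
Proof.
move=> [b0 [r [q [rr yq _]]]] [_ [r' [q' [rr' yq' _]]]].
move=> /segP[j js]; rewrite (line_opt _ yq) => xj.
move=> /segP[j' js']; rewrite (line_opt _ yq') => xj'.
have key : (q * s)%N%:Z + (0 + j)%N%:Z = (q' * s)%N%:Z + (0 + j')%N%:Z.
  have back (r1 r2 : Omega N) (k k' : int) : is_root b r1 ->
     at_point x (line (opt r1) b k) -> at_point x (line (opt r2) b k') -> k' <= k.
    move=> rr1 xk xk'; have := line_back xk' => h; rewrite (line_opt _ xk) in h.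
    by have := root_first rr1 h; lia.
  by apply/eqP; rewrite eq_le (back r' r) // (back r r').
have qq : q = q'.
  have := divnMDl q j (leq_ltn_trans (leq0n _) js); rewrite (divn_small js) addn0 => <-.
  have := divnMDl q' j' (leq_ltn_trans (leq0n _) js); rewrite (divn_small js') addn0 => <-.
  by congr (_ %/ _)%N; lia.
have jj : j = j' by move: key; rewrite qq; lia.
have h := line_back xj; have h' := line_back xj'.
have rr1 : r = r' by apply: at_point_inj h _; rewrite key.
by rewrite rr1 qq in yq; apply: at_point_inj yq yq'.
Qed.

Lemma block_gap_le s b y : block_start s b y -> forall e, (`|b e|%N * s.-1 <= (N e).-1)%N.
Proof.
move=> [_ [r [q [_ _ [z /at_pointP zs]]]]] e; have := zs e.
rewrite /line /opt; case: (z e) (y e) => k kN [k' k'N] /= h.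
have : `|s.-1%:Z * b e| <= (N e).-1%:Z by lia.
by rewrite normrM; lia.
Qed.

(** Differences with [|b e| <= N e] as a finite type, stored with offset [N e]; every progression
    with two points in the box has one of these. *)
Definition gaps := Omega (fun e => (2 * N e).+1).
Definition gap (B : gaps) : 'I_d -> int := fun e => (B e)%:Z - (N e)%:Z.

Definition good_gap s (B : gaps) :=
  [exists e, gap B e != 0] && [forall e, (`|gap B e|%N * s.-1 <= (N e).-1)%N].

Lemma good_gapP s B : good_gap s B ->
  (exists e, gap B e != 0) /\ forall e, (`|gap B e|%N * s.-1 <= (N e).-1)%N.
Proof. by case/andP => /existsP h1 /forallP h2. Qed.

(** Coordinates of a good gap lie between [- m e] and [m e]. The boolean factor gives 0 when all
    [m e] vanish, since only the excluded difference 0 would remain. *)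
Lemma card_good_gap s (m : 'I_d -> nat) : (1 < s)%N ->
  (forall e, m e = ((N e).-1 %/ s.-1)%N) ->
  (#|good_gap s| <= [exists e, 0 < m e]%N * \prod_(e < d) (2 * m e).+1)%N.
Proof.
move=> s1 mE; have sp : (0 < s.-1)%N by lia.
have mle (B : gaps) e : good_gap s B -> (`|gap B e|%N <= m e)%N.
  by move=> /good_gapP[_ /(_ e)]; rewrite mE leq_divRL.
have [h|h] := boolP [exists e, (0 < m e)%N]; last first.
  rewrite mul0n leqn0; apply/eqP/eq_card0 => B; apply/negbTE/negP => gB.
  have [[e be] _] := good_gapP gB; move: h; rewrite negb_exists => /forallP/(_ e).
  by have := mle B e gB; lia.
rewrite mul1n; pose f (B : gaps) : Omega (fun e => (2 * m e).+1) :=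
  [ffun e => inord (absz (gap B e + (m e)%:Z)%R)].
have finj : {in good_gap s &, injective f}.
  move=> B B' gB gB' /ffunP fE; apply/ffunP => e; apply: val_inj.
  have := congr1 val (fE e); rewrite /f !ffunE.
  have := mle B e gB; have := mle B' e gB' => h1 h2.
  rewrite /= !inordK; try lia.
  by move: h1 h2; rewrite /gap /=; lia.
rewrite -(card_in_imset finj); apply: leq_trans (max_card _) _.
by rewrite card_Omega.
Qed.

Lemma sum_blocks_le s x :
  (\sum_(B : gaps) \sum_y (`[< block_start s (gap B) y >] && in_block s (gap B) y x)
    <= #|good_gap s|)%N.
Proof.
rewrite -sum1_card [leqRHS]big_mkcond; apply: leq_sum => B _.
have [[y /andP[/asboolP ys xy]]|h] := pselect (exists y,
    `[< block_start s (gap B) y >] && in_block s (gap B) y x); last first.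
  by rewrite big1 // => y _; apply/eqP; rewrite eqb0; apply/negP => yy; apply: h; exists y.
have -> : B \in good_gap s.
  apply/andP; split; first by apply/existsP; case: ys.
  by apply/forallP; apply: block_gap_le ys.
rewrite (bigD1 y) //= big1 ?addn0 => [|y' yy']; first exact: leq_b1.
apply/eqP; rewrite eqb0; apply: contra yy' => /andP[/asboolP ys' xy'].
by apply/eqP; apply: block_unique ys' ys xy' xy.
Qed.

End Blocks.

(** * Factorization of the prefix matrix *)

Section Factorization.
Variables (R : realType) (d : nat) (N : 'I_d -> nat) (L : R) (s0 K : nat).
Hypothesis L_ge1 : 1 <= L.
Hypothesis prod_le : forall I : {set 'I_d}, (\prod_(e in I) N e)%N%:R <= L ^+ #|I|.+1.
Hypothesis s0_ge : L <= s0.-1%:R.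
Implicit Types (x y z r : Omega N).

Definition scale (i : nat) := (2 ^ i * s0)%N.
(** The ratio 3/2 lies between 1 and 2: against [3^d L / 2^i] gaps it leaves the series of
    [(3/4)^i], and its inverse the series of [(2/3)^i]. *)
Definition weight (i : nat) : R := (3 / 2) ^+ i / (8 * 3 ^+ d * L).

Lemma s0_gt1 : (1 < s0)%N.
Proof.
have : 1 <= s0.-1%:R :> R := le_trans L_ge1 s0_ge.
by rewrite ler1n; lia.
Qed.

Lemma c3L_gt0 : 0 < 8 * 3 ^+ d * L.
Proof. by rewrite !mulr_gt0 ?exprn_gt0 // (lt_le_trans ltr01). Qed.

Lemma weight_gt0 i : 0 < weight i.
Proof. by rewrite divr_gt0 ?c3L_gt0 // exprn_gt0 // divr_gt0. Qed.

Lemma scale_pred_ge i : 2 ^+ i * L <= (scale i).-1%:R.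
Proof.
apply: le_trans (_ : 2 ^+ i * s0.-1%:R <= _); first by rewrite ler_wpM2l ?exprn_ge0.
rewrite -natrX -natrM ler_nat /scale; have := s0_gt1.
have : (0 < 2 ^ i)%N by rewrite expn_gt0.
by move: (2 ^ i)%N => p; nia.
Qed.

(** With [I] the coordinates where [m e > 0], the count is at most [3^d L^(|I|+1) / (2^i L)^|I|],
    and [|I| >= 1]. *)
Lemma card_good_gap_le i :
  #|@good_gap d N (scale i)|%:R <= 3 ^+ d * L / 2 ^+ i :> R.
Proof.
have sL := scale_pred_ge i; have L0 : 0 < L := lt_le_trans ltr01 L_ge1.
have p0 : 0 < 2 ^+ i :> R by rewrite exprn_gt0.
have p1 : 1 <= 2 ^+ i :> R by rewrite exprn_ege1 // ler1n.
have pL : 0 < 2 ^+ i * L by rewrite mulr_gt0.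
have s1 : (1 < scale i)%N.
  by have : 0 < (scale i).-1%:R :> R := lt_le_trans pL sL; rewrite ltr0n; lia.
pose m e := ((N e).-1 %/ (scale i).-1)%N.
have := card_good_gap s1 (fun e => erefl (m e)); rewrite -/m.
pose I := [set e | (0 < m e)%N].
have [h|h] := boolP [exists e, (0 < m e)%N]; last first.
  rewrite mul0n leqn0 => /eqP ->; rewrite divr_ge0 ?mulr_ge0 ?exprn_ge0 //; exact: ltW.
have I0 : (0 < #|I|)%N.
  by have [e me] := existsP h; rewrite card_gt0; apply/set0Pn; exists e; rewrite inE.
rewrite mul1n -(ler_nat R) => /le_trans; apply.
have mle e : (m e)%:R <= (N e)%:R / (2 ^+ i * L).
  rewrite ler_pdivlMr //; apply: le_trans (_ : (m e * (scale i).-1)%N%:R <= _).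
    by rewrite natrM ler_wpM2l.
  by rewrite ler_nat; apply: leq_trans (leq_divM _ _) _; apply: leq_pred.
apply: le_trans (_ : \prod_e (3 * (if e \in I then (m e)%:R else 1)) <= _).
  rewrite natr_prod; apply: ler_prod => e _; rewrite ler0n /= inE.
  case: posnP => [->|me] //; first by rewrite ?mulr1 ler_nat.
  by rewrite -natrM ler_nat; lia.
rewrite big_split /= prodr_const card_ord -mulrA ler_pM2l ?exprn_gt0 //.
rewrite -big_mkcond /=.
apply: le_trans (_ : \prod_(e in I) ((N e)%:R / (2 ^+ i * L)) <= _).
  by apply: ler_prod => e _; rewrite ler0n mle.
rewrite big_split /= prodr_const -natr_prod exprVn.
rewrite ler_pdivrMr ?exprn_gt0 //; apply: le_trans (prod_le I) _.
have pk : 2 ^+ i <= (2 ^+ i) ^+ #|I| :> R.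
  by move: I0; case: #|I| => // k _; rewrite exprS ler_peMr ?(ltW p0) // exprn_ege1.
rewrite exprMn exprS (_ : L / 2 ^+ i * _ = L * L ^+ #|I| * ((2 ^+ i) ^+ #|I| / 2 ^+ i)); last by ring.
by rewrite ler_peMr ?ler_pdivlMr ?mul1r // ltW // mulr_gt0 // exprn_gt0.
Qed.

Lemma geo34 n : \sum_(i < n) (3 / 4) ^+ i <= 4 :> R.
Proof.
suff -> : \sum_(i < n) (3 / 4) ^+ i = 4 - 4 * (3 / 4) ^+ n :> R.
  by rewrite gerBl mulr_ge0 // exprn_ge0 // divr_ge0.
by elim: n => [|n IH]; [rewrite big_ord0 expr0; ring|rewrite big_ord_recr IH exprS /=; field].
Qed.

Lemma geo23 n : \sum_(i < n) (2 / 3) ^+ i <= 3 :> R.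
Proof.
suff -> : \sum_(i < n) (2 / 3) ^+ i = 3 - 3 * (2 / 3) ^+ n :> R.
  by rewrite gerBl mulr_ge0 // exprn_ge0 // divr_ge0.
by elim: n => [|n IH]; [rewrite big_ord0 expr0; ring|rewrite big_ord_recr IH exprS /=; field].
Qed.

Lemma sum_weight_inv n : \sum_(i < n) (weight i)^-1 <= 24 * 3 ^+ d * L.
Proof.
rewrite (eq_bigr (fun i : 'I_n => 8 * 3 ^+ d * L * (2 / 3) ^+ i)) => [|i _]; last first.
  by rewrite /weight invf_div -exprVn invf_div.
rewrite -mulr_sumr; apply: le_trans (_ : 8 * 3 ^+ d * L * 3 <= _).
  by rewrite ler_pM2l ?c3L_gt0 // geo23.
by rewrite le_eqVlt; apply/orP; left; apply/eqP; ring.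
Qed.

Definition coordT : finType := (Omega N + 'I_K * gaps N * Omega N)%type.

Definition col_entry x (t : coordT) : R := match t with
  | inl y => if x == y then 1 / 2 else 0
  | inr (i, B, y) => if `[< block_start (scale i) (gap B) y >]
                        && in_block (scale i) (gap B) y x
                     then Num.sqrt (weight i) else 0
  end.

Definition col_vec x : {ffun coordT -> R^o} := [ffun t => col_entry x t].

Lemma sum_coord (F : coordT -> R) :
  \sum_t F t = \sum_y F (inl y) + \sum_i \sum_B \sum_y F (inr (i, B, y)).
Proof.
rewrite big_sumType /=; congr (_ + _).
by rewrite pair_bigA pair_bigA; apply: eq_bigr => -[[i B] y].
Qed.

(** The point itself contributes 1/4. At each scale at most one block per good gap contains [x], and
    all blocks contribute at most 1/2. *)
Lemma col_le1 x : dot (col_vec x) (col_vec x) <= 1.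
Proof.
rewrite /dot sum_coord (bigD1 x) //= big1 => [|y /negPf yx]; last first.
  by rewrite !ffunE /col_entry eq_sym yx mul0r.
rewrite !ffunE /col_entry eqxx addr0.
apply: le_trans (_ : 1 / 4 + \sum_(i < K) weight i * #|@good_gap d N (scale i)|%:R <= _).
  apply: lerD; first by lra.
  apply: ler_sum => i _.
  apply: le_trans (_ : weight i * (\sum_(B : gaps N) \sum_y (`[< block_start (scale i) (gap B) y >]
      && in_block (scale i) (gap B) y x))%N%:R <= _); last first.
    by rewrite ler_pM2l ?weight_gt0 // ler_nat sum_blocks_le.
  rewrite natr_sum mulr_sumr; apply: ler_sum => B _.
  rewrite natr_sum mulr_sumr; apply: ler_sum => y _.
  rewrite !ffunE /col_entry; case: ifP => _; last by rewrite !mulr0.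
  by rewrite -expr2 sqr_sqrtr ?mulr1 // ltW ?weight_gt0.
apply: le_trans (_ : 1 / 4 + \sum_(i < K) (3 / 4) ^+ i / 8 <= _); last first.
  by rewrite -mulr_suml; have := geo34 K; lra.
rewrite lerD2l; apply: ler_sum => i _.
apply: le_trans (ler_wpM2l (ltW (weight_gt0 i)) (card_good_gap_le i)) _.
rewrite le_eqVlt; apply/orP; left; apply/eqP.
have L0 : L != 0 by rewrite gt_eqF // (lt_le_trans ltr01).
have d0 : 3 ^+ d != 0 :> R by rewrite expf_neq0 ?pnatr_eq0.
have i0 : 2 ^+ i != 0 :> R by rewrite expf_neq0 ?pnatr_eq0.
have i4 : 4 ^+ i = 2 ^+ i * 2 ^+ i :> R by rewrite -exprMn; congr (_ ^+ i); rewrite -natrM.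
rewrite /weight !expr_div_n i4; field.
by rewrite d0 i0 L0.
Qed.

Definition basis_vec (t0 : coordT) : {ffun coordT -> R^o} := [ffun t => (t == t0)%:R].

Lemma dot_basis (t0 : coordT) (f : {ffun coordT -> R^o}) : dot (basis_vec t0) f = f t0.
Proof.
rewrite /dot (bigD1 t0) //= ffunE eqxx mul1r big1 ?addr0 // => t /negPf h.
by rewrite ffunE h mul0r.
Qed.

(** Binary expansion of the length: each scale splits off at most one aligned block, and fewer than
    [s0] single points remain. Vanishing from scale [i] on makes the next block orthogonal, so
    squared norms add. *)
Lemma seg_rep (B : gaps N) r i : (exists e, gap B e != 0) -> is_root (gap B) r ->
  (i <= K)%N -> forall q n, (n < scale i)%N ->
  (forall j, (j < n)%N -> exists z, at_point z (line (opt r) (gap B) (q * scale i + j)%N)) ->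
  exists u : {ffun coordT -> R^o},
    [/\ forall (i' : 'I_K) B' y, (i <= i')%N -> u (inr (i', B', y)) = 0,
        forall x, dot u (col_vec x) = (seg r (gap B) (q * scale i) n x)%:R
      & dot u u <= 4 * s0%:R + \sum_(j < i) (weight j)^-1].
Proof.
move=> b0 rr; elim: i => [|i IH] iK q n ns hz.
  pose A := [set x | seg r (gap B) (q * scale 0) n x].
  (* The entry 2 undoes the 1/2 of the column; fewer than [s0] of them cost at most [4 s0]. *)
  pose f (t : coordT) : R := match t with inl y => if y \in A then 2 else 0 | _ => 0 end.
  exists [ffun t => f t : R^o]; split.
  - by move=> i' B' y _; rewrite ffunE.
  - move=> x; rewrite /dot sum_coord (bigD1 x) //= !ffunE /f /col_entry eqxx inE big1 => [|y /negPf yx]; last first.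
      by rewrite !ffunE /col_entry eq_sym yx mulr0.
    rewrite big1 => [|i' _]; last first.
      by rewrite big1 // => B' _; rewrite big1 // => y _; rewrite ffunE mul0r.
    by rewrite !addr0; case: ifP => _; [rewrite mulrC divfK ?pnatr_eq0|rewrite mul0r].
  - rewrite big_ord0 addr0 /dot sum_coord [X in _ + X]big1 => [|i' _]; last first.
      by rewrite big1 // => B' _; rewrite big1 // => y _; rewrite ffunE mul0r.
    rewrite addr0 (eq_bigr (fun y => if y \in A then 4 else 0)) => [|y _]; last first.
      by rewrite ffunE /f; case: ifP => _; rewrite ?mul0r //; ring.
    rewrite -big_mkcond sumr_const -[leLHS]mulr_natr ler_pM2l // ler_nat.
    apply: leq_trans (card_seg _ _ _ b0) _; move: ns; rewrite /scale mul1n; exact: ltnW.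
have iK' : (i < K)%N := iK.
have scaleS : scale i.+1 = (scale i + scale i)%N by rewrite /scale expnS -mulnA mul2n addnn.
have [ni|ni] := ltnP n (scale i).
  have [|u [u1 u2 u3]] := IH (ltnW iK) (q * 2)%N n ni.
    by move=> j jn; have := hz j jn; rewrite scaleS addnn -muln2 mulnA mulnAC.
  exists u; split.
  - by move=> i' B' y /ltnW; apply: u1.
  - by move=> x; rewrite u2 scaleS addnn -muln2 mulnA mulnAC.
  - apply: le_trans u3 _; rewrite lerD2l big_ord_recr lerDl invr_ge0; exact/ltW/weight_gt0.
have s_gt0 : (0 < scale i)%N by rewrite muln_gt0 expn_gt0 /= ltnW // s0_gt1.
have qE : (q * scale i.+1)%N = (q * 2 * scale i)%N by rewrite scaleS addnn -muln2 mulnA mulnAC.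
have qE' : ((q * 2).+1 * scale i = q * scale i.+1 + scale i)%N by rewrite qE mulSn addnC.
have nE : n = (scale i + (n - scale i))%N by rewrite subnKC.
have [||u [u1 u2 u3]] := IH (ltnW iK) (q * 2).+1 (n - scale i)%N.
- by move: ns; rewrite scaleS; lia.
- move=> j jn; have [|z zj] := hz (scale i + j)%N; first by lia.
  by exists z; rewrite qE' -addnA.
have [|y yq] := hz 0%N; first by lia.
have [|z zq] := hz (scale i).-1; first by lia.
have ys : block_start (scale i) (gap B) y.
  split=> //; exists r, (q * 2)%N; split=> //; first by move: yq; rewrite qE addn0.
  by exists z; rewrite (line_opt _ yq) addn0 -PoszD.
pose t0 : coordT := inr (Ordinal iK', B, y).
have w0 : 0 < weight i := weight_gt0 i.
(* This coefficient cancels the column entry and costs [(weight i)^-1] in squared norm. *)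
pose a : R := (Num.sqrt (weight i))^-1.
have sw0 : Num.sqrt (weight i) != 0 by rewrite gt_eqF // sqrtr_gt0.
exists (u + a *: basis_vec t0); split.
- move=> i' B' y' ii'; rewrite !ffunE u1 ?(ltnW ii') // add0r.
  case: eqP => [[E _ _]|_]; last by rewrite mulr0n /GRing.scale /= mulr0.
  by move: ii'; rewrite E /= ltnn.
- move=> x; rewrite dotDl dotZl dot_basis u2 ffunE /col_entry /= (asboolT ys) /=.
  rewrite {2}nE seg_split // natrD addrC -qE'; congr (_ + _).
  have -> : in_block (scale i) (gap B) y x = seg r (gap B) (q * scale i.+1) (scale i) x.
    apply/segP/segP => -[j js xj]; exists j => //.
      by move: xj; rewrite (line_opt _ yq) addn0 add0n.
    by rewrite (line_opt _ yq) addn0 add0n.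
  by case: seg; rewrite ?mulr0 // mulVf.
- rewrite big_ord_recr /= addrA dotDD dotZl dotZr dot_basis dotZr (dotC u) dot_basis.
  rewrite (u1 (Ordinal iK') B y (leqnn i)) ffunE eqxx !mulr0 addr0 mulr1 lerD //.
  by rewrite -expr2 /a exprVn sqr_sqrtr // ltW.
Qed.

End Factorization.

(** * Signs balancing a finite family of vectors *)

Section MaxBalancing.
Variables (R : realType) (T I J : finType).

(** Apply the exponential bound to the [2 |J|] vectors [t th j] and [- t th j]. With [t^2 rho = l]
    the sum is at most [exp (l + 8 l)], so each exponent is at most [9 l]. *)
Lemma balancing_max (v : I -> {ffun T -> R^o}) (th : J -> {ffun T -> R^o}) (rho : R) :
  (forall i, dot (v i) (v i) <= 1) -> 0 < rho -> (forall j, dot (th j) (th j) <= rho) ->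
  (0 < #|J|)%N ->
  exists2 X : I -> R, is_sign X &
    forall j, `|dot (th j) (comb v X)| <= 9 * Num.sqrt (rho * ln (2 * #|J|)%N%:R).
Proof.
move=> v1 rho0 thle J0; set l := ln _.
have m1 : 1 < (2 * #|J|)%N%:R :> R by rewrite ltr1n; lia.
have l0 : 0 < l by rewrite ln_gt0.
have lE : expR l = (2 * #|J|)%N%:R by rewrite lnK // posrE (lt_trans _ m1).
pose s := Num.sqrt (rho * l); have s0 : 0 < s by rewrite sqrtr_gt0 mulr_gt0.
have s2 : s ^+ 2 = rho * l by rewrite sqr_sqrtr // ltW // mulr_gt0.
pose t := l / s; have t0 : 0 < t by rewrite divr_gt0.
have t2 : t ^+ 2 * rho = l.
  by rewrite /t expr_div_n s2; field; rewrite !gt_eqF.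
pose th' (p : bool * J) := (if p.1 then t else - t) *: th p.2.
have [X Xs HX] := @gram_schmidt_balancing R T I _ v th' v1 (fun=> 1) (fun=> ler01).
exists X => // j.
have {}HX p : dot (th' p) (comb v X) <= 9 * l.
  rewrite -ler_expR; apply: le_trans (_ : \sum_p 1 * expR (dot (th' p) (comb v X)) <= _).
    rewrite (bigD1 p) //= mul1r lerDl; apply: sumr_ge0 => q _.
    by rewrite mul1r expR_ge0.
  apply: le_trans HX _; apply: le_trans (_ : \sum_(p : bool * J) expR (8 * l) <= _).
    apply: ler_sum => q _; rewrite mul1r ler_expR ler_pM2l // /th' dotZl dotZr.
    rewrite mulrA -t2; apply: le_trans (ler_wpM2l (sqr_ge0 t) (thle q.2)).
    by case: q.1; rewrite ?mulrNN -expr2.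
  rewrite sumr_const card_prod card_bool -[leLHS]mulr_natl -lE -expRD ler_expR.
  by rewrite le_eqVlt; apply/orP; left; apply/eqP; ring.
have h1 := HX (true, j); have h2 := HX (false, j).
move: h1 h2; rewrite /th' /= !dotZl => h1 h2.
rewrite -(ler_pM2l t0) -/s (_ : t * (9 * s) = 9 * l); last first.
  by rewrite /t; field; rewrite gt_eqF.
by rewrite -{1}(gtr0_norm t0) -normrM ler_norml; lra.
Qed.

End MaxBalancing.

(** * A colouring with small prefix sums *)

Section Prefixes.
Variables (R : realType) (d : nat) (N : 'I_d -> nat) (L : R) (s0 K : nat).
Hypothesis L_ge1 : 1 <= L.
Hypothesis prod_le : forall I : {set 'I_d}, (\prod_(e in I) N e)%N%:R <= L ^+ #|I|.+1.
Hypothesis s0_ge : L <= s0.-1%:R.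
Hypothesis N_lt : forall e, (N e < 2 ^ K)%N.
Implicit Types (x y z r : Omega N) (b : 'I_d -> int).

Definition pre b x z := `[< exists k : nat, at_point x (line (opt z) b k) >].

(** The prefix ending at [x] is a segment from the root of its line, hence starts at the aligned
    position 0. *)
Lemma prefix_rep (B : gaps N) x : (exists e, gap B e != 0) ->
  exists u : {ffun coordT N K -> R^o},
    (forall z, dot u (col_vec L s0 K z) = (pre (gap B) x z)%:R) /\
    dot u u <= 4 * s0%:R + 24 * 3 ^+ d * L.
Proof.
move=> b0; have [r [n [rr xn [e ne]]]] := root_exists x b0.
have nK : (n.+1 < scale s0 K)%N.
  apply: leq_ltn_trans ne _; apply: leq_trans (N_lt e) _.
  by rewrite /scale leq_pmulr // ltnW // (s0_gt1 L_ge1 s0_ge).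
have [|u [_ u2 u3]] := seg_rep (K := K) L_ge1 s0_ge b0 rr (leqnn K) (q := 0) nK.
  move=> j jn; apply: (@line_between _ _ _ _ 0 _ n); [lia|lia| |by exists x].
  by exists r; apply/at_pointP => f; rewrite /line mul0r addr0.
exists u; split; last by apply: le_trans u3 _; rewrite lerD2l sum_weight_inv.
move=> z; rewrite u2 mul0n; congr ((nat_of_bool _)%:R).
apply/segP/asboolP => [[j jn zj]|[k xk]].
  exists (n - j)%N; rewrite (line_opt _ zj).
  by rewrite (_ : (0 + j)%N%:Z + (n - j)%N%:Z = n%:Z) //; lia.
have zk := line_back xk; rewrite (line_opt _ xn) in zk.
have := root_first rr zk => kn; exists (n - k)%N; first by lia.
by rewrite (_ : (0 + (n - k))%N%:Z = n%:Z + - k%:Z) //; lia.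
Qed.

Lemma prefix_coloring (rho : R) : rho = 4 * s0%:R + 24 * 3 ^+ d * L -> (0 < #|Omega N|)%N ->
  exists chi : {ffun Omega N -> bool}, forall (B : gaps N) x, (exists e, gap B e != 0) ->
    `|(\sum_z sgc chi z * (pre (gap B) x z : nat)%:Z)%:~R|
      <= 9 * Num.sqrt (rho * ln (2 * (#|Omega N| * #|gaps N|))%N%:R) :> R.
Proof.
move=> rhoE N0.
have rho0 : 0 < rho.
  rewrite rhoE ltr_wpDl ?mulr_ge0 // !mulr_gt0 ?exprn_gt0 // (lt_le_trans ltr01) //.
have /choice[u uP] : forall p : Omega N * gaps N, exists u : {ffun coordT N K -> R^o},
    dot u u <= rho /\ ((exists e, gap p.2 e != 0) ->
      forall z, dot u (col_vec L s0 K z) = (pre (gap p.2) p.1 z)%:R).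
  move=> [x B]; have [b0|b0] := pselect (exists e, gap B e != 0).
    by have [u [u1 u2]] := prefix_rep x b0; exists u; rewrite rhoE; split.
  (* The zero gap receives the zero vector, so that the family is indexed by all pairs. *)
  by exists 0; rewrite dot0l; split=> //; rewrite ltW.
have J0 : (0 < #|{: Omega N * gaps N}|)%N.
  by rewrite card_prod muln_gt0 N0 card_Omega prodn_gt0.
have [X Xs HX] := balancing_max (col_le1 K L_ge1 prod_le s0_ge) rho0
  (fun p => (uP p).1) J0.
exists [ffun x => X x == 1] => B x b0; have := HX (x, B); rewrite card_prod.
congr (`|_| <= _); rewrite dotC dot_suml rmorph_sum /=; apply: eq_bigr => z _.
rewrite dotZl dotC (uP (x, B)).2 // rmorphM /= /sgc ffunE.
have : -1 != 1 :> R by apply/eqP; lra.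
by case: (Xs z) => ->; rewrite ?eqxx // => /negPf ->; rewrite ?rmorphN.
Qed.

End Prefixes.

(** * The upper bound *)

Section UpperBound.
Variables (R : realType) (d : nat) (N : 'I_d -> nat).

(** A progression is the prefix of its last point minus the prefix of its first point, plus that
    first point. *)
Lemma AP_sum_le (chi : {ffun Omega N -> bool}) (D : R) : 0 <= D ->
  (forall (B : gaps N) x, (exists e, gap B e != 0) ->
    `|(\sum_z sgc chi z * (pre (gap B) x z : nat)%:Z)%:~R| <= D) ->
  forall A, is_AP A -> (absz (chi_sum chi A))%:R <= 2 * D + 1.
Proof.
move=> D0 HD A [a [b [l [b0 [l0 [abox memA]]]]]].
pose p e := a e - 1.
have pbox k : (k < l)%N -> exists x : Omega N, at_point x (line p b k).
  by move=> /abox h; apply: exists_at_point => e; have := h e; rewrite /line /p; lia.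
have inA z : reflect (exists2 k : nat, (k < l)%N & at_point z (line p b k)) (z \in A).
  apply: (iffP idP) => [/memA[k kl zk]|[k kl /at_pointP zk]].
    by exists k => //; apply/at_pointP => e; have := zk e; rewrite /pt /line /p; lia.
  by apply/memA; exists k => // e; have := zk e; rewrite /pt /line /p; lia.
have sgc1 z : `|sgc chi z| = 1 by rewrite /sgc; case: (chi z).
have sumE : chi_sum chi A = \sum_z sgc chi z * (z \in A : nat)%:Z.
  rewrite /chi_sum big_mkcond; apply: eq_bigr => z _.
  by case: (z \in A); rewrite ?mulr1 ?mulr0.
have [x0 x0p] := pbox 0%N l0.
(* A single point is treated apart, since its [b] may be too large to be a [gap]. *)
have [l1|l1] := leqP l 1.
  have A1 : A = [set x0].
    apply/setP => z; rewrite inE; apply/inA/eqP => [[k kl zk]|->]; last by exists 0%N.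
    by apply: at_point_inj zk _; rewrite (_ : k = 0%N) //; lia.
  rewrite /chi_sum A1 big_set1 -/(sgc chi x0) (_ : absz _ = 1%N); first by lra.
  by have := sgc1 x0; lia.
have [x1 x1p] := pbox l.-1 ltac:(lia).
have [x' x'p] := pbox 1%N l1.
have bN e : `|b e| <= (N e)%:Z.
  by have := at_point_bounds e x0p; have := at_point_bounds e x'p; rewrite /line; lia.
have [B gB] : exists B : gaps N, gap B = b.
  have [|B /at_pointP BE] := @exists_at_point d (fun e => (2 * N e).+1) (fun e => b e + (N e)%:Z).
    by move=> e; have := bN e; lia.
  by exists B; apply/funext => e; rewrite /gap BE addrK.
have BE x : `|(\sum_z sgc chi z * (pre b x z : nat)%:Z)%:~R| <= D.
  by rewrite -gB; apply: HD; rewrite gB.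
have base (z : Omega N) (i : int) : at_point z (line p b i) ->
    forall j, line (opt z) b j = line p b (i + j).
  by move=> /at_pointP zi j; apply/funext => e; rewrite {1}/line /opt zi /line; ring.
have memE z : (z \in A : nat)%:Z =
    (pre b x1 z : nat)%:Z - (pre b x0 z : nat)%:Z + (z == x0 : nat)%:Z.
  have [[k xk]|h0] := pselect (exists k : nat, at_point x0 (line (opt z) b k)).
    have zk := line_back xk; rewrite (base _ _ x0p) add0r in zk.
    rewrite /pre (asboolT (ex_intro _ k xk)) (_ : `[< _ >] = true); last first.
      apply/asboolP; exists (k + l.-1)%N; rewrite (base _ _ zk).
      by rewrite (_ : - k%:Z + (k + l.-1)%N%:Z = l.-1) //; lia.
    rewrite subrr add0r; congr ((nat_of_bool _)%:Z).
    apply/inA/eqP => [[k' kl zk']|->]; last by exists 0%N.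
    have kk := line_inj b0 zk zk'; apply: at_point_inj zk' _.
    by rewrite (_ : k' = 0%N) //; lia.
  have z0 : z != x0.
    apply/eqP => zx; apply: h0; exists 0%N; rewrite zx; apply/at_pointP => e.
    by rewrite /line mul0r addr0.
  rewrite (negPf z0) addr0 [pre b x0 z]/pre (asboolF h0) subr0; congr ((nat_of_bool _)%:Z).
  apply/inA/asboolP => [[k kl zk]|[k xk]].
    exists (l.-1 - k)%N; rewrite (base _ _ zk).
    by rewrite (_ : k%:Z + (l.-1 - k)%N%:Z = l.-1) //; lia.
  have zk := line_back xk; rewrite (base _ _ x1p) in zk.
  have [kl|kl] := leqP k l.-1.
    exists (l.-1 - k)%N; first by lia.
    by rewrite (_ : (l.-1 - k)%N%:Z = l.-1%:Z + - k%:Z) //; lia.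
  case: h0; exists (k - l.-1)%N; rewrite (base _ _ zk).
  by rewrite (_ : l.-1%:Z - k%:Z + (k - l.-1)%N%:Z = 0) //; lia.
have -> : (absz (chi_sum chi A))%:R = `|(chi_sum chi A)%:~R| :> R.
  by rewrite -intr_norm -abszE.
have -> : chi_sum chi A = \sum_z sgc chi z * (pre b x1 z : nat)%:Z
    - \sum_z sgc chi z * (pre b x0 z : nat)%:Z + sgc chi x0.
  rewrite sumE (eq_bigr _ (fun z _ => congr1 _ (memE z))).
  under eq_bigr do rewrite mulrDr mulrBr.
  rewrite big_split sumrB /=; congr (_ + _); rewrite (bigD1 x0) //= eqxx mulr1.
  by rewrite big1 ?addr0 // => z /negPf ->; rewrite mulr0.
rewrite rmorphD rmorphB /=; apply: le_trans (ler_normD _ _) _.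
rewrite -[X in _ + X <= _]intr_norm sgc1 lerD2r.
by apply: le_trans (ler_normB _ _) _; have := BE x1; have := BE x0; lra.
Qed.

Lemma disc_upper (L : R) (s0 K : nat) : (0 < #|Omega N|)%N -> 1 <= L ->
  (forall I : {set 'I_d}, (\prod_(e in I) N e)%N%:R <= L ^+ #|I|.+1) ->
  L <= s0.-1%:R -> (forall e, (N e < 2 ^ K)%N) ->
  (disc N)%:R <= 18 * Num.sqrt ((4 * s0%:R + 24 * 3 ^+ d * L)
                   * ln (2 * (#|Omega N| * #|gaps N|))%N%:R) + 1.
Proof.
move=> N0 L1 PL s0L NK.
have [chi Hchi] := prefix_coloring L1 PL s0L NK erefl N0.
set D := 9 * Num.sqrt _ in Hchi.
have D0 : 0 <= D by rewrite mulr_ge0 ?sqrtr_ge0.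
have HA := AP_sum_le D0 Hchi.
have DE : 0 <= 2 * D + 1 by lra.
apply: le_trans (_ : 2 * D + 1 <= _); last by rewrite /D; lra.
have /andP[t1 t2] := truncn_itv DE.
apply: le_trans t1; rewrite ler_nat; apply: (disc_le (chi := chi)) => A /HA h.
by rewrite -ltnS -(ltr_nat R); apply: le_lt_trans h t2.
Qed.

End UpperBound.

(** * Numerical facts on logarithms *)

Section Numeric.
Variable R : realType.

(** It makes [ln (ln P)] positive for [P >= 3]. The proof uses [exp (-1) >= (5/6)^6] and
    [3 (5/6)^6 > 1]. *)
Lemma ln3_gt1 : 1 < ln 3 :> R.
Proof.
rewrite -ltr_expR lnK ?posrE //.
have h : (5 / 6) ^+ 6 <= expR (-1) :> R.
  rewrite (_ : -1 = 6%:R * - (1 / 6)); last by field.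
  rewrite expRM_natl lerXn2r ?nnegrE ?expR_ge0 ?divr_ge0 //.
  by have := expR_ge1Dx (- (1 / 6) : R); lra.
have h1 := expRxMexpNx_1 (1 : R); have e0 := expR_gt0 (1 : R).
rewrite ltNge; apply/negP => h3.
have : 3 * (5 / 6) ^+ 6 <= 1 :> R.
  by rewrite -[leRHS]h1; apply: ler_pM => //; rewrite exprn_ge0 // divr_ge0.
rewrite leNgt => /negP; apply; rewrite -subr_gt0.
rewrite (_ : 3 * (5 / 6) ^+ 6 - 1 = 73 / 15552); last by field.
by rewrite divr_gt0.
Qed.

(** Because [ln z = 2 ln (sqrt z) <= 2 sqrt z]; it is applied to [z = ln P]. *)
Lemma sqrt_le_div_ln (z : R) : 1 < z -> Num.sqrt z <= 2 * (z / ln z).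
Proof.
move=> z1; have z0 : 0 < z := lt_trans ltr01 z1.
have lz : 0 < ln z by rewrite ln_gt0.
pose y := Num.sqrt z; have y0 : 0 < y by rewrite sqrtr_gt0.
have zE : z = y ^+ 2 by rewrite sqr_sqrtr // ltW.
have h : ln z <= 2 * y.
  have ly : ln y <= y - 1.
    have := @expR_ge1Dx R (ln y); rewrite lnK ?posrE //; lra.
  have -> : ln z = 2 * ln y by rewrite zE lnXn // mulr_natl.
  lra.
rewrite mulrA ler_pdivlMr //; apply: le_trans (ler_wpM2l (ltW y0) h) _.
by rewrite mulrCA -expr2 -zE.
Qed.

End Numeric.

Theorem disc_le_log_Mfac (R : realType) (d : nat) : exists2 C : R, 0 < C &
  forall N : 'I_d -> nat, (forall i, (0 < N i)%N) -> (3 <= \prod_(i < d) N i)%N ->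
    (disc N)%:R <= C * (ln ((\prod_(i < d) N i)%N%:R : R)
                        / ln (ln ((\prod_(i < d) N i)%N%:R : R))) * Mfac R N.
Proof.
pose c1 : R := ln (2 * 3 ^+ d) + 2.
have d1 : 1 <= 3 ^+ d :> R by rewrite exprn_ege1 // ler1n.
have c10 : 0 < c1 by rewrite ltr_wpDl // ln_ge0 //; lra.
pose S := Num.sqrt (3 ^+ d * c1); have S0 : 0 <= S by apply: sqrtr_ge0.
(* Here 108 is 18 times the 6 of [sqU], the 1 absorbs the additive 1 of [disc_upper], and the factor
   2 is that of [sqrt_le_div_ln]. *)
exists (2 * (108 * S + 1)) => [|N N_gt0 P3]; first by rewrite mulr_gt0 //; lra.
set P := (\prod_(i < d) N i)%N in P3 *; set M := Mfac R N.
have cardN : #|Omega N| = P by rewrite card_Omega.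
have M1 : 1 <= M.
  apply: le_trans (le_bigmax 0 _ (set0 : {set 'I_d})).
  by rewrite big_set0 powR1.
have M0 : 0 < M := lt_le_trans ltr01 M1.
pose L := M ^+ 2; have L1 : 1 <= L by rewrite exprn_ege1.
have PL (I : {set 'I_d}) : (\prod_(e in I) N e)%N%:R <= L ^+ #|I|.+1.
  rewrite -(Mterm_pow R N_gt0) lerXn2r ?nnegrE ?exprn_ge0 ?(ltW M0) //.
    by rewrite ltW // Mterm_gt0.
  rewrite lerXn2r ?nnegrE ?(ltW M0) //; first by rewrite ltW // Mterm_gt0.
  exact: (le_bigmax 0 (fun J => Mterm R N J) I).
have /andP[t1 t2] := truncn_itv (le_trans ler01 L1).
pose s0 := (Num.truncn L).+2.
have s0L : L <= s0.-1%:R by rewrite ltW.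
have s0U : s0%:R <= 3 * L by rewrite /s0 -addn2 natrD; lra.
(* The bound of [disc_upper] is uniform in [K], so the crude [K = P] suffices. *)
have NK e : (N e < 2 ^ P)%N.
  apply: leq_ltn_trans (ltn_expl P (isT : (1 < 2)%N)).
  by rewrite /P (bigD1 e) //= leq_pmulr // prodn_gt0.
have N0 : (0 < #|Omega N|)%N by rewrite cardN (leq_trans _ P3).
apply: le_trans (disc_upper N0 L1 PL s0L NK) _; rewrite cardN.
set lP := ln P%:R.
have P1 : 1 < P%:R :> R by rewrite ltr1n (leq_trans _ P3).
have P0 : 0 < P%:R :> R := lt_trans ltr01 P1.
have lP1 : 1 < lP.
  apply: lt_le_trans (ln3_gt1 R) _.
  by rewrite ler_ln ?posrE // ler_nat.
have gapsU : (#|gaps N| <= 3 ^ d * P)%N.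
  rewrite card_Omega -[d in (3 ^ d)%N]card_ord -prod_nat_const -big_split /=.
  by apply: leq_prod => e _; rewrite (mulSn 2) -add1n leq_add2r N_gt0.
have gaps0 : (0 < #|gaps N|)%N by rewrite card_Omega prodn_gt0.
have Pn0 : (0 < P)%N by apply: leq_trans P3.
(* The logarithm is at most [ln (2 3^d) + 2 ln P], and [ln P > 1] absorbs the constant. *)
have lnU : ln (2 * (P * #|gaps N|))%N%:R <= c1 * lP.
  apply: le_trans (_ : ln (2 * 3 ^+ d * P%:R ^+ 2) <= _).
    rewrite ler_ln ?posrE; last 2 first.
    - by rewrite ltr0n !muln_gt0 Pn0 gaps0.
    - by rewrite !mulr_gt0 ?exprn_gt0.
    rewrite -!natrX -!natrM ler_nat.
    by rewrite -mulnA leq_mul2l /= -mulnn mulnCA leq_mul2l gapsU orbT.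
  rewrite lnM ?posrE ?exprn_gt0 ?mulr_gt0 ?exprn_gt0 // lnXn // -/lP.
  have l30 : 0 <= ln (2 * 3 ^+ d) :> R by rewrite ln_ge0 //; lra.
  rewrite (_ : lP *+ 2 = 2 * lP); last by rewrite mulr_natl.
  by rewrite /c1 (mulrDl (ln _)) lerD2r ler_peMr // ltW.
have lP0 : 0 < lP := lt_trans ltr01 lP1.
(* As [s0 <= 3 L], the first factor is at most [36 3^d L], and [L = M^2] gives the [6 M]. *)
have sqU : Num.sqrt ((4 * s0%:R + 24 * 3 ^+ d * L) * ln (2 * (P * #|gaps N|))%N%:R)
    <= 6 * M * S * Num.sqrt lP.
  rewrite -[leRHS]ger0_norm; last by rewrite !mulr_ge0 ?sqrtr_ge0 // ltW.
  rewrite -sqrtr_sqr; apply: ler_wsqrtr.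
  rewrite !exprMn !sqr_sqrtr ?(ltW lP0) //; last by rewrite mulr_ge0 ?exprn_ge0 ?ltW.
  apply: le_trans (_ : (36 * 3 ^+ d * L) * (c1 * lP) <= _); last by rewrite /L; lra.
  apply: ler_pM => //.
  - by rewrite addr_ge0 ?mulr_ge0 ?exprn_ge0 // ltW.
  - by rewrite ln_ge0 // ler1n !muln_gt0 Pn0 gaps0.
  - by have : L <= 3 ^+ d * L by [rewrite ler_peMl // (le_trans ler01)]; lra.
have zU := sqrt_le_div_ln lP1.
have sl1 : 1 <= Num.sqrt lP by rewrite -[leLHS]sqrtr1 ler_sqrt // ltW.
have Ms1 : 1 <= M * Num.sqrt lP by rewrite mulr_ege1.
apply: le_trans (_ : (108 * S + 1) * (M * Num.sqrt lP) <= _); first by lra.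
have c0 : 0 <= 108 * S + 1 by lra.
apply: le_trans (ler_wpM2l c0 (ler_wpM2l (ltW M0) zU)) _.
by rewrite le_eqVlt; apply/orP; left; apply/eqP; ring.
Qed.

Theorem theorem1p3 (R : realType) (d : nat) : (0 < d)%N ->
  exists c C : R, 0 < c /\ 0 < C /\
    forall N : 'I_d -> nat, (forall i, (0 < N i)%N) ->
      (3 <= \prod_(i < d) N i)%N ->
      c * Mfac R N <= (disc N)%:R /\
      (disc N)%:R <= C * (ln ((\prod_(i < d) N i)%N%:R : R)
                          / ln (ln ((\prod_(i < d) N i)%N%:R : R))) * Mfac R N.
Proof.
move=> _; have [C C0 HC] := disc_le_log_Mfac R d.
have c0 : 0 < (8 * 3 ^ d)%N%:R :> R by rewrite ltr0n muln_gt0 expn_gt0.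
exists (8 * 3 ^ d)%N%:R^-1, C; split; first by rewrite invr_gt0.
split=> // N N_gt0 P3; split; last exact: HC.
rewrite mulrC ler_pdivrMr // mulrC -natrM.
by apply: Mfac_le_disc => //; apply: leq_trans P3.
Qed.
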